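(* For any $\nu<0$: (i) $\psi(\nu)$ decreases in $\sigma$ and in $\nu$ and increases in $\alpha$; $\phi(\nu)$ increases in $\sigma$ and decreases in $\nu$ and in $\alpha$. (ii) The exit threshold $\xi(\nu)$ decreases in $\sigma$ and in $\nu$, and it increases in $\alpha$. (iii) The optimal return $V(x;\nu)$ increases in $\sigma$ and in $\nu$ for $x>\xi(\nu)$. (In each case the remaining parameters among $\alpha>0,\sigma>0,\nu<0$ are held fixed.)
   Context: $\alpha>0$ is the discount rate, $\sigma>0$ the volatility, $\nu$ the drift. Define $$\psi(\nu)=\frac{-\nu+\sqrt{\nu^2+2\alpha\sigma^2}}{\sigma^2},\qquad \phi(\nu)=\frac{-\nu-\sqrt{\nu^2+2\alpha\sigma^2}}{\sigma^2},\qquad \xi(\nu)=\frac{\sigma^2}{\nu-\sqrt{\nu^2+2\alpha\sigma^2}}.$$ $V(x;\nu)=\sup_\tau E[\int_0^\tau e^{-\alpha t}(x+\nu t+\sigma B_t)\,dt]$, where $B_t$ is a standard Brownian motion and the supremum is over all stopping times with values in $[0,\infty]$; explicitly, $V(x;\nu)=\frac{x}{\alpha}+\frac{\nu}{\alpha^2}-\frac{1}{\alpha\phi(\nu)}e^{\phi(\nu)(x-\xi(\nu))}$ for $x>\xi(\nu)$ and $V(x;\nu)=0$ for $x\le\xi(\nu)$ ($\xi(\nu)$ is the optimal exit threshold). *)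

(* Defs.v *)
From HB Require Import structures.
From mathcomp Require Import all_boot all_order all_algebra.
From mathcomp Require Import all_classical all_reals all_analysis.

Set Implicit Arguments.
Unset Strict Implicit.
Unset Printing Implicit Defensive.

Import Order.TTheory GRing.Theory Num.Theory.
Import numFieldTopology.Exports numFieldNormedType.Exports.

Local Open Scope classical_set_scope.
Local Open Scope ring_scope.

Section thresholds.
Variable R : realType.
Implicit Types alpha sigma nu : R.

Definition psi alpha sigma nu : R :=
  (- nu + Num.sqrt (nu ^+ 2 + 2 * alpha * sigma ^+ 2)) / sigma ^+ 2.

Definition phi alpha sigma nu : R :=
  (- nu - Num.sqrt (nu ^+ 2 + 2 * alpha * sigma ^+ 2)) / sigma ^+ 2.

Definition xi alpha sigma nu : R :=
  sigma ^+ 2 / (nu - Num.sqrt (nu ^+ 2 + 2 * alpha * sigma ^+ 2)).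

End thresholds.

(* Time is the half-line [0, +oo[ of R: families indexed by R are only
   constrained, and only used, at nonnegative times. *)
Section optimal_stopping.
Context d (Omega : measurableType d) (R : realType) (P : probability Omega R).
Implicit Types (F : R -> set_system Omega) (B : R -> {RV P >-> R}).

Record filtration F : Prop := Filtration {
  filtration_sigma : forall t : R, 0 <= t -> sigma_algebra setT (F t) ;
  filtration_measurable : forall t : R, 0 <= t -> F t `<=` measurable ;
  filtration_mono : forall s t : R, 0 <= s -> s <= t -> F s `<=` F t }.

Definition increment B (s t : R) : Omega -> R := fun w => B t w - B s w.

(* Standard Brownian motion relative to the filtration F; taking for F the
   filtration generated by B gives the notion without reference to F. *)
Record brownian_motion F B : Prop := BrownianMotion {
  bm_adapted : forall t : R, 0 <= t ->
    forall C : set R, measurable C -> F t (B t @^-1` C) ;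
  bm_start : forall w, B 0 w = 0 ;
  bm_continuous : forall w, {within `[0, +oo[, continuous (fun t : R => B t w)} ;
  bm_independent : forall s t : R, 0 <= s -> s < t ->
    forall (A : set Omega) (C : set R), F s A -> measurable C ->
    P (A `&` increment B s t @^-1` C) = (P A * P (increment B s t @^-1` C))%E ;
  (* the second parameter of normal_prob is the standard deviation *)
  bm_normal : forall s t : R, 0 <= s -> s < t ->
    forall C : set R, measurable C ->
    P (increment B s t @^-1` C) = normal_prob 0 (Num.sqrt (t - s)) C }.

Definition stopping_time F (tau : Omega -> \bar R) : Prop :=
  (forall w, 0 <= tau w)%E /\
  (forall t : R, 0 <= t -> F t [set w | (tau w <= t%:E)%E]).

Definition discounted_return B (alpha sigma x nu : R) (tau : Omega -> \bar R) :
    \bar R :=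
  (\int[P]_w \int[lebesgue_measure]_(t in [set t : R | (0 <= t%:E <= tau w)%E])
     (expR (- (alpha * t)) * (x + nu * t + sigma * B t w))%:E)%E.

Definition optimal_return F B (alpha sigma x nu : R) : \bar R :=
  ereal_sup [set discounted_return B alpha sigma x nu tau |
             tau in stopping_time F].

End optimal_stopping.

(* Main.v *)
Require Import Defs.
From HB Require Import structures.
From mathcomp Require Import all_boot all_order all_algebra.
From mathcomp Require Import all_classical all_reals all_analysis.
From mathcomp Require Import measurable_realfun ring lra.

Set Implicit Arguments.
Unset Strict Implicit.
Unset Printing Implicit Defensive.

Import Order.TTheory GRing.Theory Num.Theory.
Import numFieldTopology.Exports numFieldNormedType.Exports.

Local Open Scope classical_set_scope.
Local Open Scope ring_scope.

(** The formulas for [psi], [phi] and [xi] reduce parts (i) and (ii) to the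
    monotonicity of [rad = sqrt (nu ^ 2 + 2 alpha sigma ^ 2)] in [sigma] and
    [alpha], and to [rad] being a strict contraction of [nu]; note that
    [xi = - 1 / psi].

    Part (iii) concerns a supremum over stopping times on an arbitrary filtered
    space. It is proved by convexity, with no explicit formula for the value
    and no stochastic calculus. For a fixed stopping time [tau] the expected
    return [J (sigma, nu, tau)] is affine in the pair [(sigma, nu)]. Hence, if
    the middle of three parameters is a convex combination of the outer two, if
    all returns at the first one are at most [e], and if some return at the
    last one exceeds [e], then the optimal return strictly increases from the
    middle to the last ([ereal_sup_interpolation_lt]).
    - For [sigma], the first parameter is [0]. Without noise the best policy
      is to stop at the deterministic time [t0 = max 0 (- x / nu)] at which
      [x + nu t] changes sign ([deterministic_optimal]), and the return of a
      deterministic time does not depend on [sigma].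
    - For [nu], the first parameter is a very negative drift, for which all
      returns are uniformly small: the positive part of the state is dominated
      by an exponential whose moments are explicit ([payoff_integral_le]).

    What remains is that for [xi < x] some stopping time does strictly better
    than the deterministic time [t0] ([expected_payoff_gt]). This is the only
    place where the threshold matters, and it has to be sharp. After [t0] the
    state is observed on a grid of step [h], and one stops when it falls below
    a barrier [b] slightly above [xi]. Let [G (z) = z / alpha + nu / alpha ^ 2]
    be the return of never stopping and let
    [W (z) = G (z) - G (b) exp (K (b - z))], which vanishes at [b]. The function
    [exp (- K z)] is strictly subharmonic for the discounted process as soon as
    [K > - phi], while [W] is increasing at [b] as soon as
    [K < - 1 / (alpha G (b))]; both are possible exactly because [b > xi]
    ([barrier_exists]). Continuing for one step while above [b] gains at least
    the variation of [W], up to the values of [W] reached by overshooting the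
    barrier. Since [W] is negative just below [b], overshooting is harmful only
    beyond a fixed distance. This costs at most a term that is exponentially
    small in [h ^ (-1/2)], while the strict subharmonicity gains a term of order
    [h] ([small_step_exists], [grid_step]). Summing over the grid, the strategy
    earns at least [E (W (X_t0); X_t0 >= b)] beyond [t0], discounted, and up to
    a final term that vanishes with the number of steps. This is positive
    because [W (z)] dominates a positive multiple of [z - b] and the mean of
    [X_t0] is above [b].

    The only facts about Brownian motion that are used are the factorization
    of exponential moments over increments ([integral_expB_step]), the
    martingale property ([Rintegral_B_step]), and joint measurability, which
    comes from the continuity of paths ([measurable_path]). *)

(** * Densities and Gaussian exponential moments *)

Section density.
Context d (T : measurableType d) (R : realType).
Variables (nu mu : {measure set T -> \bar R}) (p : T -> R).
Hypothesis p0 : forall x, 0 <= p x.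
Hypothesis mp : measurable_fun setT p.
Hypothesis nuE : forall A, measurable A ->
  nu A = (\int[mu]_(x in A) (p x)%:E)%E.

Local Open Scope ereal_scope.
Import HBNNSimple.

Lemma ge0_integral_density (f : T -> \bar R) :
  (forall x, 0 <= f x) -> measurable_fun setT f ->
  \int[nu]_x f x = \int[mu]_x (f x * (p x)%:E).
Proof.
move=> f0 mf; pose h := nnsfun_approx measurableT mf.
have hf x : EFin \o h ^~ x @ \oo --> f x.
  by apply: cvg_nnsfun_approx => //.
have -> : \int[nu]_x f x = limn (fun n => \int[nu]_x (h n x)%:E).
  rewrite -monotone_convergence//.
  - by apply: eq_integral => x _; apply/esym/cvg_lim => //; exact: hf.
  - by move=> n; exact/measurable_EFinP.
  - by move=> n x _; rewrite lee_fin.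
  - by move=> x _ a b ab; rewrite lee_fin; exact/lefP/nd_nnsfun_approx.
have -> : \int[mu]_x (f x * (p x)%:E) =
    limn (fun n => \int[mu]_x ((h n x)%:E * (p x)%:E)).
  rewrite -monotone_convergence//.
  - apply: eq_integral => x _; apply/esym/cvg_lim => //.
    by apply: cvgeZr => //; exact: hf.
  - by move=> n; apply: emeasurable_funM; exact/measurable_EFinP.
  - by move=> n x _; rewrite mule_ge0 ?lee_fin.
  - move=> x _ a b ab; rewrite lee_wpmul2r ?lee_fin//.
    exact/lefP/nd_nnsfun_approx.
congr (limn _); apply/funext => n.
transitivity (\int[nu]_x
   (\sum_(y \in range (h n)) (y * \1_(h n @^-1` [set y]) x)%:E)).
  by apply: eq_integral => t tE; rewrite fimfunE -fsumEFin.
have mi r : measurable_fun setT (fun x => (r * \1_(h n @^-1` [set r]) x)%:E).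
  by apply/measurable_EFinP; exact: measurable_funM.
rewrite ge0_integral_fsum//; last by move=> y x _; exact: nnfun_muleindic_ge0.
transitivity (\int[mu]_x (\sum_(y \in range (h n))
    (y * \1_(h n @^-1` [set y]) x)%:E * (p x)%:E)); last first.
  apply: eq_integral => x _.
  rewrite -ge0_mule_fsuml => [|y]; last exact: nnfun_muleindic_ge0.
  by rewrite fsumEFin // -(fimfunE _ x).
rewrite ge0_integral_fsum//; last 2 first.
  - by move=> y; apply: emeasurable_funM => //; exact/measurable_EFinP.
  - by move=> y x _; apply: mule_ge0; [exact: nnfun_muleindic_ge0|rewrite lee_fin].
apply: eq_fsbigr => r rhn.
have mr : measurable (h n @^-1` [set r]) by [].
rewrite integralZl_indic_nnsfun // integral_indic// setIT nuE//.
under [RHS]eq_integral do rewrite EFinM -muleA.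
rewrite ge0_integralZl//.
- congr (_ * _); rewrite integral_mkcond; apply: eq_integral => x _.
  by rewrite muleC epatch_indic.
- by apply: emeasurable_funM; exact/measurable_EFinP.
- by move=> t _; rewrite mule_ge0 ?lee_fin.
- by move: rhn; rewrite inE => -[t _ <-]; rewrite lee_fin.
Qed.

End density.

Section normal_mgf.
Context (R : realType).
Local Notation mu := (@lebesgue_measure R).

(** Completing the square turns the tilted density into a multiple of the density
    of mean [c s ^ 2]. *)
Lemma normal_mgf (c s : R) : s != 0 ->
  (\int[normal_prob 0 s]_y (expR (c * y))%:E = (expR (c ^+ 2 * s ^+ 2 / 2))%:E)%E.
Proof.
move=> s0; rewrite (@ge0_integral_density _ _ _ _ mu (normal_pdf 0 s)).
- under eq_integral => y _.
    rewrite -EFinM (_ : expR (c * y) * normal_pdf 0 s y =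
      expR (c ^+ 2 * s ^+ 2 / 2) * normal_pdf (c * s ^+ 2) s y); last first.
      rewrite !normal_pdfE//= /normal_fun mulrCA [RHS]mulrCA -!expRD; congr (_ * expR _).
      by field.
    rewrite EFinM; over.
  rewrite ge0_integralZl_EFin//= ?expR_ge0//.
  + by rewrite integral_normal_pdf mule1.
  + by move=> y _; rewrite lee_fin normal_pdf_ge0.
  + by apply/measurable_EFinP; have := measurable_normal_pdf (c * s ^+ 2) s.
- by move=> x; have := normal_pdf_ge0 0 s x.
- by have := measurable_normal_pdf 0 s.
- by [].
- by move=> x; rewrite lee_fin expR_ge0.
- by apply/measurable_EFinP/measurableT_comp => //; exact: measurable_funM.
Qed.

End normal_mgf.

(** * Independence of the past and of increments *)

Section restriction.
Context d (T : measurableType d) (R : realType) (m : {measure set T -> \bar R}).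
Local Open Scope ereal_scope.

Lemma ge0_integral_mrestr (A : set T) (mA : measurable A) (f : T -> \bar R) :
  (forall x, 0 <= f x) -> measurable_fun setT f ->
  \int[mrestr m mA]_x f x = \int[m]_(x in A) f x.
Proof.
move=> f0 mf.
rewrite (@ge0_integral_density _ _ _ _ m \1_A)//.
  by rewrite [RHS]integral_mkcond; apply: eq_integral => x _; rewrite epatch_indic.
by move=> C mC; rewrite integral_indic// /mrestr setIC.
Qed.

End restriction.

Section finite_image.
Context d d' (T1 : measurableType d) (T2 : measurableType d') (R : realType).

(** The measurability proof is an argument so that it can be recovered when the
    measure structure of the image is inferred. *)
Definition image_measure (m : {finite_measure set T1 -> \bar R}) (f : T1 -> T2)
  of measurable_fun setT f : set T2 -> \bar R := pushforward m f.

Variables (m : {finite_measure set T1 -> \bar R}) (f : T1 -> T2).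
Hypothesis mf : measurable_fun setT f.
Local Notation mu := (image_measure m mf).

Let mu0 : mu set0 = 0%E.
Proof. by rewrite /image_measure /pushforward preimage_set0 measure0. Qed.

Let mu_ge0 A : (0 <= mu A)%E. Proof. exact: measure_ge0. Qed.

Let mu_sigma_additive : semi_sigma_additive mu.
Proof.
exact: (@measure_semi_sigma_additive _ _ _
  (measure_function_pushforward__canonical__measure_function_Measure m mf)).
Qed.

HB.instance Definition _ := isMeasure.Build _ _ _ mu
  mu0 mu_ge0 mu_sigma_additive.

Let mu_fin : fin_num_fun mu.
Proof.
move=> A mA; rewrite /image_measure/pushforward fin_num_measure//.
by rewrite -[X in measurable X]setTI; exact: mf.
Qed.

HB.instance Definition _ := @Measure_isFinite.Build _ _ _ mu mu_fin.

Lemma ge0_integral_image (g : T2 -> \bar R) :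
  (forall y, 0 <= g y)%E -> measurable_fun setT g ->
  (\int[mu]_y g y = \int[m]_x g (f x))%E.
Proof.
move=> g0 mg; rewrite (eq_measure_integral
  (measure_function_pushforward__canonical__measure_function_Measure m mf))//.
by rewrite ge0_integral_pushforward// preimage_setT.
Qed.

End finite_image.

Section brownian_increments.
Context d (Omega : measurableType d) (R : realType) (P : probability Omega R).
Variables (F : R -> set_system Omega) (B : R -> {RV P >-> R}).
Hypotheses (HF : filtration F) (HB : brownian_motion F B).

Lemma filtration_measurable_set (t : R) (A : set Omega) :
  0 <= t -> F t A -> measurable A.
Proof. by move=> t0; exact: filtration_measurable HF _ t0 _. Qed.

Lemma measurable_increment (s t : R) : measurable_fun setT (increment B s t).
Proof. by apply: measurable_funB; exact: measurable_funPT. Qed.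

Lemma filtrationI (t : R) (A C : set Omega) :
  0 <= t -> F t A -> F t C -> F t (A `&` C).
Proof.
move=> t0; have /sigma_algebraP[//|_ _ _] := filtration_sigma HF t0.
exact.
Qed.

Lemma filtrationC (t : R) (A : set Omega) : 0 <= t -> F t A -> F t (~` A).
Proof.
by move=> t0; have [_ + _] := filtration_sigma HF t0; rewrite -setTD => /[apply].
Qed.

Lemma filtrationT (t : R) : 0 <= t -> F t setT.
Proof.
move=> t0; rewrite -setC0; apply: filtrationC => //.
by have [] := filtration_sigma HF t0.
Qed.

Lemma adapted_ge (t b : R) : 0 <= t -> F t [set w | b <= B t w].
Proof.
move=> t0; have := bm_adapted HB t0 (measurable_itv `[b, +oo[).
by congr (F t _); apply/seteqP; split => w /=; rewrite in_itv/= andbT.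
Qed.

(** Independence is only assumed for events. On rectangles it says that the joint
    law of [B s] on [A] and of the increment is a product, and Tonelli's theorem
    does the rest. *)
Lemma ge0_integral_increment (s t : R) (A : set Omega) (f g : R -> R) :
  0 <= s -> s < t -> F s A ->
  (forall y, 0 <= f y) -> (forall y, 0 <= g y) ->
  measurable_fun setT f -> measurable_fun setT g ->
  (\int[P]_(w in A) (f (B s w) * g (increment B s t w))%:E =
   \int[P]_(w in A) (f (B s w))%:E *
   \int[P]_w (g (increment B s t w))%:E)%E.
Proof.
move=> s0 st FA f0 g0 mf mg; have mA := filtration_measurable_set s0 FA.
have mB : measurable_fun setT (B s) by exact: measurable_funPT.
have mi := measurable_increment s t.
have mX : measurable_fun setT (fun w => (B s w, increment B s t w)).
  exact: measurable_fun_pair.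
pose h (z : R * R) := (f z.1 * g z.2)%:E.
have mh : measurable_fun setT h.
  by apply/measurable_EFinP/measurable_funM; apply: measurableT_comp.
have h0 z : (0 <= h z)%E by rewrite lee_fin mulr_ge0.
pose PA := mrestr P mA.
transitivity (\int[image_measure PA mX]_z h z)%E.
  rewrite ge0_integral_image// ge0_integral_mrestr//.
  exact: (measurableT_comp mh mX).
transitivity (\int[image_measure PA mB \x image_measure P mi]_z h z)%E.
  apply/esym; apply: eq_measure_integral => C mC _.
  apply: product_measure_unique => // C1 C2 mC1 mC2.
  rewrite /image_measure/pushforward/= /PA/= /mrestr/=.
  rewrite -(bm_independent HB)//.
    by congr (P _); apply/seteqP; split => w /=; tauto.
  by apply: filtrationI => //; exact: (bm_adapted HB).
rewrite fubini_tonelli1//.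
under eq_integral => y _.
  rewrite /fubini_F /h/=.
  under eq_integral do rewrite EFinM.
  rewrite ge0_integralZl_EFin//; last 2 first.
    by move=> z _; rewrite lee_fin.
    exact/measurable_EFinP.
  over.
rewrite ge0_integralZr//=; first last.
- by apply: integral_ge0 => y _; rewrite lee_fin.
- by move=> y _; rewrite lee_fin.
- exact/measurable_EFinP.
have mfB : measurable_fun setT (fun w => (f (B s w))%:E).
  by apply/measurable_EFinP; exact: measurableT_comp.
have fE0 y : (0 <= (f y)%:E)%E by rewrite lee_fin.
have gE0 y : (0 <= (g y)%:E)%E by rewrite lee_fin.
have mfE : measurable_fun setT (fun y => (f y)%:E) by exact/measurable_EFinP.
have mgE : measurable_fun setT (fun y => (g y)%:E) by exact/measurable_EFinP.
by rewrite !ge0_integral_image// ge0_integral_mrestr.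
Qed.

Lemma increment_mgf (c s t : R) : 0 <= s -> s < t ->
  (\int[P]_w (expR (c * increment B s t w))%:E =
   (expR (c ^+ 2 * (t - s) / 2))%:E)%E.
Proof.
move=> s0 st; have mi : measurable_fun setT
  (increment B s t : Omega -> measurableTypeR R).
  exact: measurable_increment.
have me : measurable_fun [set: measurableTypeR R]
    (fun y : measurableTypeR R => (expR (c * y))%:E).
  by apply/measurable_EFinP/measurableT_comp => //; exact: measurable_funM.
have st0 : 0 < t - s by rewrite subr_gt0.
transitivity (\int[image_measure P mi]_y (expR (c * y))%:E)%E.
  by rewrite ge0_integral_image.
rewrite (eq_measure_integral (normal_prob 0 (Num.sqrt (t - s)))).
  by rewrite normal_mgf ?sqr_sqrtr// ?ltW// gt_eqF// sqrtr_gt0.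
by move=> C mC _; exact: (bm_normal HB s0 st mC).
Qed.

End brownian_increments.

(** * Moments of Brownian motion *)

Lemma normr_le_expRD (R : realType) (y : R) : `|y| <= expR y + expR (- y).
Proof.
have h1 := expR_ge1Dx y; have h2 := expR_ge1Dx (- y).
have h3 := expR_gt0 y; have h4 := expR_gt0 (- y).
by case: ler0P => h5; lra.
Qed.

Lemma expR_sub1_le (R : realType) (v : R) : 0 <= v -> v <= 2^-1 -> expR v - 1 <= 2 * v.
Proof.
move=> v0 v1; have h := expR_ge1Dx (- v).
have : expR v * expR (- v) = 1 by rewrite -expRD subrr expR0.
have := expR_gt0 v; nra.
Qed.

Section brownian_moments.
Context d (Omega : measurableType d) (R : realType) (P : probability Omega R).
Variables (F : R -> set_system Omega) (B : R -> {RV P >-> R}).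
Hypotheses (HF : filtration F) (HB : brownian_motion F B).

Let measurable_expB (c t : R) : measurable_fun setT (fun w => (expR (c * B t w))%:E).
Proof.
by apply/measurable_EFinP/measurableT_comp => //; exact: measurable_funM.
Qed.

Lemma integral_expB_step (c s t : R) (A : set Omega) :
  0 <= s -> s <= t -> F s A ->
  (\int[P]_(w in A) (expR (c * B t w))%:E =
   \int[P]_(w in A) (expR (c * B s w))%:E *
   (expR (c ^+ 2 * (t - s) / 2))%:E)%E.
Proof.
move=> s0; rewrite le_eqVlt => /predU1P[<- _|st FA].
  by rewrite subrr mulr0 mul0r expR0 mule1.
rewrite -(increment_mgf HB c s0 st).
rewrite -(ge0_integral_increment HF HB (f := fun y => expR (c * y))
  (g := fun y => expR (c * y)))//.
- apply: eq_integral => w _; rewrite -expRD -mulrDr /increment.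
  by rewrite [B s w + _]addrC subrK.
- by apply: measurableT_comp => //; exact: measurable_funM.
- by apply: measurableT_comp => //; exact: measurable_funM.
Qed.

Lemma integral_expB (c t : R) : 0 <= t ->
  (\int[P]_w (expR (c * B t w))%:E = (expR (c ^+ 2 * t / 2))%:E)%E.
Proof.
move=> t0; rewrite (integral_expB_step c (lexx 0) t0 (filtrationT HF (lexx 0))).
under eq_integral do rewrite (bm_start HB) mulr0 expR0.
have PT : P setT = 1%E := probability_setT P.
by rewrite integral_cst// [X in (_ * X * _)%E]PT !mul1e subr0.
Qed.

Lemma integrable_expB (c t : R) : 0 <= t ->
  P.-integrable setT (fun w => (expR (c * B t w))%:E).
Proof.
move=> t0; apply/integrableP; split => //.
under eq_integral do rewrite gee0_abs ?lee_fin ?expR_ge0//.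
by rewrite integral_expB// ltry.
Qed.

Lemma integrable_B (t : R) : 0 <= t -> P.-integrable setT (fun w => (B t w)%:E).
Proof.
move=> t0; apply: (@le_integrable _ _ _ _ _ _ _
  (fun w => (expR (1 * B t w))%:E + (expR (-1 * B t w))%:E)%E) => //.
- exact/measurable_EFinP.
- move=> w _; rewrite mul1r mulN1r -EFinD !abse_EFin lee_fin.
  rewrite [leRHS]ger0_norm ?addr_ge0 ?expR_ge0//; exact: normr_le_expRD.
- by apply: integrableD => //; exact: integrable_expB.
Qed.

Let integrable_B_on (t : R) (A : set Omega) : 0 <= t -> measurable A ->
  P.-integrable A (fun w => (B t w)%:E).
Proof. by move=> t0 mA; apply: (integrableS measurableT) => //; exact: integrable_B. Qed.

Let integrable_expB_on (c t : R) (A : set Omega) : 0 <= t -> measurable A ->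
  P.-integrable A (fun w => (expR (c * B t w))%:E).
Proof. by move=> t0 mA; apply: (integrableS measurableT) => //; exact: integrable_expB. Qed.

Lemma Rintegral_expB_step (c s t : R) (A : set Omega) :
  0 <= s -> s <= t -> F s A ->
  \int[P]_(w in A) expR (c * B t w) =
  (\int[P]_(w in A) expR (c * B s w)) * expR (c ^+ 2 * (t - s) / 2).
Proof.
move=> s0 st FA; rewrite /Rintegral (integral_expB_step c s0 st FA) fineM//.
have mA := filtration_measurable_set HF s0 FA.
by apply: integrable_fin_num => //; exact: integrable_expB_on.
Qed.

(** The mean [I] of the increment on [A] vanishes because of exponential moments
    alone: [c I <= exp (c ^ 2 (t - s) / 2) - 1] for all [c] of either sign, and
    the right-hand side is quadratic in [c]. *)
Lemma Rintegral_B_step (s t : R) (A : set Omega) :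
  0 <= s -> s <= t -> F s A -> \int[P]_(w in A) B t w = \int[P]_(w in A) B s w.
Proof.
move=> s0; rewrite le_eqVlt => /predU1P[<- //|st FA].
have t0 : 0 <= t by apply: ltW; exact: le_lt_trans st.
have mA := filtration_measurable_set HF s0 FA.
have ii : P.-integrable A (EFin \o increment B s t).
  by apply: (@integrableB _ _ _ P A mA (fun w => (B t w)%:E) (fun w => (B s w)%:E));
    exact: integrable_B_on.
apply/eqP; rewrite -subr_eq0 -RintegralB//; [|exact: integrable_B_on..].
rewrite -[\int[P]_(x in A) _]/(\int[P]_(x in A) increment B s t x).
set I := Rintegral _ _ _.
have mi := measurable_increment B s t.
have key c : c * I <= expR (c ^+ 2 * (t - s) / 2) - 1.
  have iexp : (\int[P]_(w in A) (expR (c * increment B s t w))%:E =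
      P A * (expR (c ^+ 2 * (t - s) / 2))%:E)%E.
    rewrite -(increment_mgf HB c s0 st).
    have := ge0_integral_increment HF HB (f := cst 1) (g := fun y => expR (c * y))
      s0 st FA.
    under eq_integral do rewrite /= mul1r.
    rewrite /= integral_cst// mul1e => -> //.
    by apply: measurableT_comp => //; exact: measurable_funM.
  have PA1 : fine (P A) <= 1.
    rewrite -lee_fin fineK ?fin_num_measure//; exact: probability_le1.
  have PA0 : 0 <= fine (P A) by rewrite fine_ge0.
  have ie : P.-integrable A (EFin \o (fun w => expR (c * increment B s t w))).
    apply/integrableP; split.
      apply: measurable_funTS; apply/measurable_EFinP/measurableT_comp => //.
      exact: measurable_funM.
    under eq_integral do rewrite /= ger0_norm ?expR_ge0//.
    rewrite iexp -[P A]fineK ?fin_num_measure//; exact: ltry.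
  have -> : c * I = \int[P]_(w in A) (c * increment B s t w) by rewrite RintegralZl.
  have : \int[P]_(w in A) (c * increment B s t w) <=
      \int[P]_(w in A) (expR (c * increment B s t w) - 1).
    apply: le_Rintegral => //.
    - exact: (integrableZl mA c ii).
    - exact: (integrableB mA ie (finite_measure_integrable_cst P 1 mA)).
    - by move=> w _; have := expR_ge1Dx (c * increment B s t w); lra.
  move/le_trans; apply.
  rewrite RintegralB//; last exact: finite_measure_integrable_cst.
  rewrite Rintegral_cst// mul1r {1}/Rintegral iexp fineM ?fin_num_measure//=.
  have : 1 <= expR (c ^+ 2 * (t - s) / 2).
    rewrite -expR0 ler_expR divr_ge0// mulr_ge0 ?sqr_ge0// subr_ge0; exact: ltW.
  nra.
set u := t - s in key.
have u0 : 0 < u by rewrite /u subr_gt0.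
have small c : 0 < c -> c * u <= 1 -> c <= 1 -> `|I| <= c * u.
  move=> c0 cu c1; have v0 : 0 <= c ^+ 2 * u / 2 by rewrite divr_ge0 ?mulr_ge0 ?sqr_ge0 ?ltW.
  have vh : c ^+ 2 * u / 2 <= 2^-1 by nra.
  have := expR_sub1_le v0 vh => e.
  have k1 := le_trans (key c) e.
  have := key (- c); rewrite sqrrN => /le_trans /(_ e) k2.
  rewrite -(ler_pM2l c0) -{1}(gtr0_norm c0) -normrM ler_norml; apply/andP; split; nra.
rewrite -normr_eq0 eq_le normr_ge0 andbT leNgt; apply/negP => I0.
(* c := |I| / (2 (1 + u) (1 + u + |I|)) meets the conditions of [small], although
   c u < |I| *)
have q0 : 0 < 1 + u + `|I| by lra.
have qu : 0 < 1 + u by lra.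
have e0 : 0 < `|I| / (2 * (1 + u) * (1 + u + `|I|)) by rewrite divr_gt0// !mulr_gt0.
have [h1 h2] : let c := `|I| / (2 * (1 + u) * (1 + u + `|I|)) in
    c * (1 + u) <= 1 /\ c * u < `|I|.
  split.
    rewrite mulrAC ler_pdivrMr ?mulr_gt0// mul1r; nra.
  rewrite mulrAC ltr_pdivrMr ?mulr_gt0//; nra.
have := small _ e0 _ _; move: h1 h2 e0; set c := _ / _ => h1 h2 e0 /(_ _ _) hs.
have := hs; have cu : c * u <= 1 by nra.
have c1 : c <= 1 by nra.
by move/(_ cu c1); lra.
Qed.

End brownian_moments.

(** * The discounted return as an integral over scenarios and times *)

Section payoff_region.
Context d (Omega : measurableType d) (R : realType) (P : probability Omega R).
Variables (F : R -> set_system Omega) (B : R -> {RV P >-> R}).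
Hypotheses (HF : filtration F) (HB : brownian_motion F B).
Local Notation leb := (@lebesgue_measure R).
Local Notation OT := (Omega * measurableTypeR R)%type.

Definition nonneg_time : set OT := [set z | 0 <= (z.2 : R)].

Definition until (tau : Omega -> \bar R) : set OT :=
  [set z | 0 <= (z.2 : R) /\ ((z.2 : R)%:E <= tau z.1)%E].

Let measurable_gt (a : R) : measurable ([set t | a < t] : set (measurableTypeR R)).
Proof. by have := measurable_itv `]a, +oo[; rewrite set_itvE. Qed.

Let measurable_co (a b : R) :
  measurable ([set t | a <= t < b] : set (measurableTypeR R)).
Proof. by have := measurable_itv `[a, b[; rewrite set_itvE. Qed.

Lemma measurable_nonneg_time : measurable nonneg_time.
Proof.
have -> : nonneg_time = setT `*` [set t | 0 <= t].
  by apply/seteqP; split=> -[w t] // -[].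
by apply: measurableX => //; have := measurable_itv `[(0 : R), +oo[; rewrite set_itvE.
Qed.

(** The times after [tau] are covered by countably many rectangles, one for each
    rational that separates [tau] from the current time. *)
Lemma measurable_until (tau : Omega -> \bar R) :
  stopping_time F tau -> measurable (until tau).
Proof.
move=> [tau0 tauF].
pose C (q : rat) : set OT := [set w | (tau w <= (ratr q)%:E)%E] `*` [set t | (ratr q : R) < t].
have -> : until tau = nonneg_time `\` \bigcup_q C q.
  apply/seteqP; split => -[w t]; rewrite /until/nonneg_time/C/=.
    move=> [t0 tt]; split => // -[q _ [/= h1 h2]].
    by have := le_trans tt h1; rewrite lee_fin leNgt h2.
  move=> [t0 h]; split => //; rewrite leNgt; apply/negP => ht.
  apply: h; have := tau0 w; case E : (tau w) ht => [r| |]//; rewrite lte_fin => rt _.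
  have [q] := rat_in_itvoo rt; rewrite in_itv/= => /andP[rq qt].
  by exists q => //; split => //=; rewrite E lee_fin ltW.
apply: measurableD; first exact: measurable_nonneg_time.
apply: bigcupT_measurable_rat => q; apply: measurableX; last exact: measurable_gt.
have [q0|q0] := leP 0 (ratr q : R).
  exact: (filtration_measurable HF q0 (tauF _ q0)).
rewrite (_ : [set w | _] = set0)//; apply/seteqP; split => w //=.
by move=> /(le_trans (tau0 w)); rewrite lee_fin leNgt q0.
Qed.

(** A path is the limit of its samples at the grid points [k / (n + 1)], rounding
    time down; each sampled process is measurable, as a countable gluing of
    rectangles. *)
Lemma measurable_path : measurable_fun nonneg_time (fun z => B z.2 z.1).
Proof.
pose g n (t : R) : R := (Num.trunc (t * n.+1%:R))%:R / n.+1%:R.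
apply: (@measurable_fun_cvg _ _ _ _ (fun n (z : OT) => B (g n z.2) z.1)).
- move=> n _ Y mY.
  have -> : nonneg_time `&` (fun z : OT => B (g n z.2) z.1) @^-1` Y =
    \bigcup_k ((B (k%:R / n.+1%:R) @^-1` Y) `*`
      [set t | (k%:R / n.+1%:R : R) <= t < k.+1%:R / n.+1%:R]).
    apply/seteqP; split => -[w t]; rewrite /nonneg_time/=.
      move=> [t0 Bt]; exists (Num.trunc (t * n.+1%:R)) => //; split => //=.
      rewrite ler_pdivrMr// ltr_pdivlMr//.
      by apply: truncn_itv; rewrite mulr_ge0.
    move=> [k _ [/= Bt]]; rewrite ler_pdivrMr// ltr_pdivlMr// => h.
    have t0 : 0 <= t.
      by have /andP[+ _] := h; move/(le_trans (ler0n R k)); rewrite pmulr_lge0.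
    by split => //; rewrite /g (truncn_def h).
  apply: bigcupT_measurable => k; apply: measurableX; last exact: measurable_co.
  by rewrite -[X in measurable X]setTI; exact: measurable_funPT.
- move=> [w t]; rewrite /nonneg_time/= => t0.
  have gt : g n t @[n --> \oo] --> t.
    apply/cvgrPdist_le => e e0; near=> n.
    have /andP[h1 h2] := @truncn_itv R (t * n.+1%:R) ltac:(by rewrite mulr_ge0).
    have n0 : 0 < n.+1%:R :> R by [].
    have gE : g n t * n.+1%:R = (Num.trunc (t * n.+1%:R))%:R by rewrite /g divfK.
    have ne : 1 <= e * n.+1%:R.
      rewrite -ler_pdivrMr// mul1r; apply: ltW.
      by near: n; exact: (near_infty_natSinv_lt (PosNum e0)).
    have h3 : t * n.+1%:R < g n t * n.+1%:R + 1 by rewrite gE natr1.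
    rewrite -gE in h1.
    rewrite ger0_norm; last by rewrite subr_ge0 -(ler_pM2r n0).
    rewrite -(ler_pM2r n0) mulrBl; lra.
  apply: (@cvg_comp _ _ _ (g ^~ t) (fun s => B s w) _ (nbhs (t : subspace `[0, +oo[%classic))).
    apply/subspace_cvgP; first by rewrite /= in_itv/= t0.
    move=> S /= hS; suff : \forall n \near \oo, S (g n t) by [].
    near=> n; have : g n t \in `[0, +oo[ -> S (g n t) by near: n; exact: gt hS.
    by apply; rewrite in_itv/= andbT divr_ge0.
  exact: (@bm_continuous _ _ _ _ _ _ HB w (t : R)).
Unshelve. all: by end_near. Qed.

Section payoff.
Variables alpha sigma x nu : R.
Local Notation Q := (P \x leb)%E.

Definition payoff (z : OT) : R :=
  expR (- (alpha * z.2)) * (x + nu * z.2 + sigma * B z.2 z.1).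

Definition exp_payoff (c : R) (z : OT) : R :=
  expR (- (alpha * z.2)) * expR (c * (x + nu * z.2 + sigma * B z.2 z.1)).

(** The exponential rate at which the discounted exponential moment of the state,
    [E exp (c X_t - alpha t)], decays. *)
Definition exp_rate (c : R) : R := alpha - c * nu - c ^+ 2 * sigma ^+ 2 / 2.

Let mtime : measurable_fun nonneg_time (fun z : OT => z.2 : R).
Proof. by apply: measurable_funTS; have := @measurable_snd _ _ Omega (measurableTypeR R). Qed.

Let mstate : measurable_fun nonneg_time (fun z : OT => x + nu * z.2 + sigma * B z.2 z.1).
Proof.
apply: measurable_funD; first apply: measurable_funD => //.
- exact: measurable_funM.
- by apply: measurable_funM => //; exact: measurable_path.
Qed.

Let mdiscount : measurable_fun nonneg_time (fun z : OT => expR (- (alpha * z.2))).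
Proof. by apply: measurableT_comp => //; apply: measurableT_comp => //; exact: measurable_funM. Qed.

Lemma measurable_payoff : measurable_fun nonneg_time payoff.
Proof. exact: measurable_funM. Qed.

Lemma measurable_exp_payoff c : measurable_fun nonneg_time (exp_payoff c).
Proof.
by apply: measurable_funM => //; apply: measurableT_comp => //; exact: measurable_funM.
Qed.

Lemma integral_expN (k : R) : 0 < k ->
  (\int[leb]_(t in [set t : R | (0 <= t)%R]) (expR (- (k * t)))%:E = (k^-1)%:E)%E.
Proof.
move=> k0; have := integral_exponential_pdf k0.
have -> : [set t : R | 0 <= t] = `[0, +oo[%classic by rewrite set_itvE.
have -> : (\int[leb]_t (exponential_pdf k t)%:E =
    \int[leb]_(t in `[0%R, +oo[) (k%:E * (expR (- (k * t)))%:E))%E.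
  rewrite [RHS]integral_mkcond; apply: eq_integral => t _.
  by rewrite /exponential_pdf !patchE; case: ifP => _ //; rewrite EFinM mulNr.
rewrite ge0_integralZl_EFin ?ltW//; first last.
- by apply: measurable_funTS; apply/measurable_EFinP/measurableT_comp => //;
    apply: measurableT_comp => //; exact: measurable_funM.
move=> h; have := congr1 (fun y => (k^-1)%:E * y)%E h.
by rewrite muleA -EFinM mulVf ?gt_eqF// mul1e mule1.
Qed.

Lemma integral_exp_payoff (c : R) : 0 < exp_rate c ->
  (\int[Q]_(z in nonneg_time) (exp_payoff c z)%:E = (expR (c * x) / exp_rate c)%:E)%E.
Proof.
move=> k0; rewrite integral_mkcond fubini_tonelli2; last 2 first.
- apply/(measurable_restrictT _ measurable_nonneg_time)/measurable_EFinP.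
  exact: measurable_exp_payoff.
- move=> z; apply: erestrict_ge0 => y _.
  by rewrite lee_fin mulr_ge0 ?expR_ge0.
transitivity (\int[leb]_(t in [set t : R | (0 <= t)%R])
    ((expR (c * x))%:E * (expR (- (exp_rate c * t)))%:E))%E.
  rewrite [RHS]integral_mkcond; apply: eq_integral => t _.
  rewrite /fubini_G patchE; have [t0|t0] := leP 0 (t : R); last first.
    rewrite memNset/=; last by apply/negP; rewrite -ltNge.
    apply: integral0_eq => w _; rewrite patchE memNset// /nonneg_time/=.
    by apply/negP; rewrite -ltNge.
  rewrite mem_set//.
  transitivity (\int[P]_w ((expR (- (alpha * t) + c * (x + nu * t)))%:E *
      (expR (c * sigma * B t w))%:E))%E.
    apply: eq_integral => w _; rewrite patchE mem_set//.
    by rewrite /exp_payoff/= -!EFinM -!expRD; congr (expR _)%:E; ring.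
  rewrite ge0_integralZl_EFin//; last first.
    by apply/measurable_EFinP/measurableT_comp => //; exact: measurable_funM.
  rewrite (integral_expB HF HB)// -!EFinM -!expRD; congr (expR _)%:E.
  by rewrite /exp_rate; field.
have mN : measurable_fun [set t : R | 0 <= t]
    (fun t : measurableTypeR R => (expR (- (exp_rate c * t)))%:E).
  by apply: measurable_funTS; apply/measurable_EFinP/measurableT_comp => //;
    apply: measurableT_comp => //; exact: measurable_funM.
rewrite ge0_integralZl_EFin//.
  by rewrite integral_expN.
by have := measurable_itv `[(0 : R), +oo[; rewrite set_itvE.
Qed.

Lemma exp_payoff_ge0 c z : 0 <= exp_payoff c z.
Proof. by rewrite mulr_ge0. Qed.

Lemma integrable_exp_payoff (c : R) : 0 < exp_rate c ->
  Q.-integrable nonneg_time (EFin \o exp_payoff c).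
Proof.
move=> k0; apply/integrableP; split.
  apply/measurable_EFinP; exact: measurable_exp_payoff.
under eq_integral do rewrite /= ger0_norm ?exp_payoff_ge0//.
by rewrite integral_exp_payoff// ltry.
Qed.

(** From [y <= exp (c y) / c]: a crude bound, but its integral is explicit and it
    tends to [0] when [nu] tends to minus infinity. *)
Lemma payoff_le_exp (c : R) z : 0 < c -> payoff z <= c^-1 * exp_payoff c z.
Proof.
move=> c0; rewrite /payoff /exp_payoff mulrCA ler_wpM2l ?expR_ge0//.
rewrite ler_pdivlMl//; set y := x + _ + _.
by have := expR_ge1Dx (c * y); lra.
Qed.

Lemma normr_payoff_le (c : R) z : 0 < c ->
  `|payoff z| <= c^-1 * (exp_payoff c z + exp_payoff (- c) z).
Proof.
move=> c0; rewrite /payoff /exp_payoff -mulrDr normrM ger0_norm ?expR_ge0//.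
rewrite mulrCA ler_wpM2l ?expR_ge0// ler_pdivlMl//; set y := x + _ + _.
have -> : c * `|y| = `|c * y| by rewrite normrM gtr0_norm.
rewrite mulNr; exact: normr_le_expRD.
Qed.

Hypothesis alpha0 : 0 < alpha.

(** Discounting beats the growth of exponential moments of small order; with both
    signs this bounds the absolute value of the payoff. *)
Lemma exp_rate_gt0_near0 : exists2 c : R, 0 < c & 0 < exp_rate c /\ 0 < exp_rate (- c).
Proof.
pose m := 1 + `|nu| + sigma ^+ 2.
have m1 : 1 <= m by rewrite /m -addrA lerDl addr_ge0// sqr_ge0.
have m0 : 0 < m by lra.
pose c := Num.min 1 (alpha / (2 * m)).
have c0 : 0 < c by rewrite lt_min ltr01 divr_gt0// mulr_gt0.
have c1 : c <= 1 by rewrite ge_min lexx.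
have cm : c * m <= alpha / 2.
  rewrite -ler_pdivlMr//; apply: (@le_trans _ _ (alpha / (2 * m))).
    by rewrite ge_min lexx orbT.
  by rewrite invfM mulrA.
have cc : c ^+ 2 * sigma ^+ 2 <= c * sigma ^+ 2.
  by rewrite ler_wpM2r ?sqr_ge0// expr2 ler_piMl// ltW.
have n1 := ler_norm nu; have n2 := ler_norm (- nu); rewrite normrN in n2.
have cn1 : c * nu <= c * `|nu| by rewrite ler_pM2l.
have cn2 : c * - nu <= c * `|nu| by rewrite ler_pM2l.
have cs : 0 <= c * sigma ^+ 2 by rewrite mulr_ge0 ?sqr_ge0// ltW.
have cn : 0 <= c * `|nu| by rewrite mulr_ge0// ltW.
rewrite /m !mulrDr mulr1 in cm.
by exists c => //; rewrite /exp_rate sqrrN; split; lra.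
Qed.

Lemma integrable_payoff : Q.-integrable nonneg_time (EFin \o payoff).
Proof.
have [c c0 [k1 k2]] := exp_rate_gt0_near0.
apply: (@le_integrable _ _ _ _ _ _ _
    (fun z => (c^-1)%:E * ((exp_payoff c z)%:E + (exp_payoff (- c) z)%:E))%E).
- exact: measurable_nonneg_time.
- by apply/measurable_EFinP; exact: measurable_payoff.
- move=> z _; rewrite -EFinD -EFinM !abse_EFin lee_fin.
  apply: le_trans (ler_norm _); exact: normr_payoff_le.
- apply: integrableZl; first exact: measurable_nonneg_time.
  by apply: integrableD; [exact: measurable_nonneg_time|exact: integrable_exp_payoff..].
Qed.

Lemma integrable_payoff_on (D : set OT) : measurable D -> D `<=` nonneg_time ->
  Q.-integrable D (EFin \o payoff).
Proof.
by move=> mD DT; apply: (integrableS measurable_nonneg_time) => //; exact: integrable_payoff.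
Qed.

Lemma discounted_returnE (tau : Omega -> \bar R) : stopping_time F tau ->
  discounted_return B alpha sigma x nu tau =
  (\int[Q]_(z in until tau) payoff z)%:E.
Proof.
move=> st; have mD := measurable_until st.
have ii := integrable_payoff_on mD (fun z => @proj1 _ _).
rewrite /Rintegral fineK; last exact: integrable_fin_num.
rewrite [RHS]integral_mkcond -integral12_prod_meas1; last first.
  exact: (proj1 (@integrable_mkcond _ _ _ _ _ _ mD) ii).
rewrite /discounted_return; apply: eq_integral => w _.
rewrite integral_mkcond; apply: eq_integral => t _.
rewrite !patchE /until; congr (if _ then _ else _).
apply/idP/idP; rewrite !inE/=.
  by move=> /andP[]; rewrite lee_fin.
by move=> [? ?]; apply/andP; rewrite lee_fin.
Qed.

Lemma payoff_integral_le (c : R) (D : set OT) : 0 < c -> 0 < exp_rate c ->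
  measurable D -> D `<=` nonneg_time ->
  \int[Q]_(z in D) payoff z <= c^-1 * (expR (c * x) / exp_rate c).
Proof.
move=> c0 k0 mD DT; have mT := measurable_nonneg_time.
have ie := integrable_exp_payoff k0.
apply: (@le_trans _ _ (\int[Q]_(z in D) (c^-1 * exp_payoff c z))).
  apply: le_Rintegral => //.
  - exact: integrable_payoff_on.
  - by apply: (integrableS mT) => //; exact: (integrableZl mT _ ie).
  - by move=> z _; exact: payoff_le_exp.
rewrite RintegralZl//; last exact: (integrableS mT).
rewrite ler_pM2l ?invr_gt0// -lee_fin /Rintegral fineK; last first.
  by apply: integrable_fin_num => //; exact: (integrableS mT).
rewrite -integral_exp_payoff//; apply: ge0_subset_integral => //.
  by apply/measurable_EFinP; exact: measurable_exp_payoff.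
by move=> z _; rewrite lee_fin exp_payoff_ge0.
Qed.

End payoff.
End payoff_region.
Arguments nonneg_time {d Omega R}.

(** * Prolonging a stopping time *)

Section extension.
Context d (Omega : measurableType d) (R : realType) (P : probability Omega R).
Variables (F : R -> set_system Omega) (B : R -> {RV P >-> R}).
Hypotheses (HF : filtration F) (HB : brownian_motion F B).
Local Notation leb := (@lebesgue_measure R).
Local Notation OT := (Omega * measurableTypeR R)%type.
Local Notation Q := (P \x leb)%E.

Lemma integral_expN_affine (alpha a k s u : R) : 0 < alpha -> s < u ->
  (\int[leb]_(t in `]s, u]) (expR (- (alpha * t)) * (a + k * t))%:E =
   (expR (- (alpha * s)) * ((a + k * s) / alpha + k / alpha ^+ 2) -
    expR (- (alpha * u)) * ((a + k * u) / alpha + k / alpha ^+ 2))%:E)%E.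
Proof.
move=> alpha0 su; have an0 : alpha != 0 by rewrite gt_eqF.
pose f t := expR (- (alpha * t)) * (a + k * t).
pose H t := - (expR (- (alpha * t)) * ((a + k * t) / alpha + k / alpha ^+ 2)).
have dH (t : R) : is_derive t 1 H (f t).
  rewrite /H /f; apply: is_derive_eq.
  by rewrite /GRing.scale/=; field.
have cf : continuous f.
  move=> t; apply: differentiable_continuous; apply/derivable1_diffP.
  by rewrite /f; exact: ex_derive.
have cH : continuous H.
  by move=> t; apply: differentiable_continuous; apply/derivable1_diffP; exact: ex_derive.
rewrite integral_itv_obnd_cbnd; last first.
  by apply: measurable_funTS; apply/measurable_EFinP; exact: continuous_measurable_fun.
rewrite (@continuous_FTC2 _ f H)//.
- by rewrite /H -EFinD opprK addrC.
- by apply: continuous_subspaceT.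
- split; [by move=> t _; exact: ex_derive|..].
  + by apply: cvg_at_right_filter; exact: cH.
  + by apply: cvg_at_left_filter; exact: cH.
- by move=> t _; rewrite derive1E; apply: derive_val.
Qed.

Variables alpha sigma x nu : R.
Hypothesis alpha0 : 0 < alpha.
Local Notation payoff := (payoff B alpha sigma x nu).

Definition state (t : R) (w : Omega) : R := x + nu * t + sigma * B t w.

(** Expected discounted return, started from [z], of never stopping. *)
Definition perpetuity (z : R) : R := z / alpha + nu / alpha ^+ 2.

Let slab (A : set Omega) (s u : R) : set OT :=
  A `*` ([set t | s < t <= u] : set (measurableTypeR R)).

Let measurable_slab A s u : measurable A -> measurable (slab A s u).
Proof.
by move=> mA; apply: measurableX => //; have := measurable_itv `]s, u]; rewrite set_itvE.
Qed.

Let slab_nonneg A s u : 0 <= s -> slab A s u `<=` nonneg_time.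
Proof. by move=> s0 [w t] [_ /= /andP[st _]]; rewrite /nonneg_time/= (le_trans s0)// ltW. Qed.

Lemma integrable_state (A : set Omega) (t : R) : 0 <= t -> measurable A ->
  P.-integrable A (EFin \o state t).
Proof.
move=> t0 mA; apply: (@integrableD _ _ _ P A mA
   (fun=> (x + nu * t)%:E) (fun w => sigma%:E * (B t w)%:E)%E).
  exact: finite_measure_integrable_cst.
apply: integrableZl => //; apply: (integrableS measurableT) => //.
exact: (integrable_B HF HB).
Qed.

Lemma Rintegral_state (A : set Omega) (s t : R) : 0 <= s -> s <= t -> F s A ->
  \int[P]_(w in A) state t w =
  fine (P A) * (x + nu * t) + sigma * \int[P]_(w in A) B s w.
Proof.
move=> s0 st FA; have mA := filtration_measurable_set HF s0 FA.
have t0 := le_trans s0 st.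
have iB : P.-integrable A (EFin \o B t).
  by apply: (integrableS measurableT) => //; exact: (integrable_B HF HB).
rewrite RintegralD//.
- by rewrite Rintegral_cst// RintegralZl// (Rintegral_B_step HF HB s0 st FA) mulrC.
- exact: finite_measure_integrable_cst.
- exact: (integrableZl mA sigma iB).
Qed.

Lemma Rintegral_perpetuity (A : set Omega) (s t : R) : 0 <= s -> s <= t -> F s A ->
  \int[P]_(w in A) perpetuity (state t w) =
  (fine (P A) * (x + nu * t) + sigma * \int[P]_(w in A) B s w) / alpha
  + fine (P A) * nu / alpha ^+ 2.
Proof.
move=> s0 st FA; have mA := filtration_measurable_set HF s0 FA.
have t0 := le_trans s0 st.
have ist := integrable_state t0 mA.
rewrite -(Rintegral_state s0 st FA) RintegralD//.
- rewrite Rintegral_cst// -RintegralZr//; congr (_ + _).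
  by rewrite mulrC mulrA.
- by have := integrableZr mA alpha^-1 ist.
- exact: finite_measure_integrable_cst.
Qed.

(** The strategy of continuing from [s] to [u] on an event of the past: by the
    martingale property it is the return of never stopping from [s], minus the
    discounted return of never stopping from [u]. *)
Lemma payoff_slab (A : set Omega) (s u : R) : 0 <= s -> s < u -> F s A ->
  \int[Q]_(z in slab A s u) payoff z =
  expR (- (alpha * s)) * \int[P]_(w in A) perpetuity (state s w) -
  expR (- (alpha * u)) * \int[P]_(w in A) perpetuity (state u w).
Proof.
move=> s0 su FA; have mA := filtration_measurable_set HF s0 FA.
have mS := measurable_slab s u mA.
have iS := integrable_payoff_on HF HB sigma x nu alpha0 mS (slab_nonneg s0).
rewrite (Rintegral_perpetuity s0 (lexx s) FA) (Rintegral_perpetuity s0 (ltW su) FA).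
rewrite /Rintegral integral_mkcond -integral21_prod_meas1; last first.
  exact: (proj1 (@integrable_mkcond _ _ _ _ _ _ mS) iS).
rewrite -[in RHS]/(\int[P]_(w in A) B s w).
set p := fine (P A); set b := \int[P]_(w in A) B s w.
have itvE : [set t : R | s < t <= u] = `]s, u]%classic by rewrite set_itvE.
transitivity (fine (\int[leb]_(t in [set t : R | (s < t <= u)%R])
    (expR (- (alpha * t)) * (p * x + sigma * b + p * nu * t))%:E)); last first.
  by rewrite itvE integral_expN_affine//=; congr (_ * _ - _ * _); field; rewrite gt_eqF.
congr fine; rewrite [RHS]integral_mkcond; apply: eq_integral => t _.
rewrite /fubini_G patchE; case: ifPn => [|/negP st]; last first.
  apply: integral0_eq => w _; rewrite patchE memNset// => -[_ st'].
  by apply: st; rewrite inE.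
rewrite inE/= => st.
have /andP[st1 st2] := st.
transitivity (\int[P]_(w in A) ((expR (- (alpha * t)))%:E * (state t w)%:E))%E.
  rewrite [RHS]integral_mkcond; apply: eq_integral => w _; rewrite !patchE.
  congr (if _ then _ else _); apply/idP/idP; rewrite !inE/= ?st; first by case.
  by move=> ?; split.
have it := integrable_state (le_trans s0 (ltW st1)) mA.
rewrite integralZl// -[X in (_ * X)%E]fineK; last exact: integrable_fin_num.
rewrite -[fine _]/(\int[P]_(w in A) state t w) (Rintegral_state s0 (ltW st1) FA).
by rewrite -EFinM; congr (_ * _)%:E; rewrite -/p -/b; ring.
Qed.

Definition extend_stop (tau : Omega -> \bar R) (A : set Omega) (u : R) (w : Omega) :
  \bar R := if w \in A then u%:E else tau w.

Section extend.
Variables (tau : Omega -> \bar R) (A : set Omega) (s u : R).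
Hypotheses (s0 : 0 <= s) (su : s < u) (FA : F s A) (st_tau : stopping_time F tau).
Hypotheses (tau_le : forall w, (tau w <= s%:E)%E) (tauA : forall w, A w -> tau w = s%:E).

(** From [s] on it is known whether [A] occurs; before [s] this does not matter,
    because on [A] both times are at least [s]. *)
Lemma extend_stop_stopping : stopping_time F (extend_stop tau A u).
Proof.
have [tau0 tauF] := st_tau; split => [w|t t0].
  by rewrite /extend_stop; case: ifPn => // _; rewrite lee_fin (le_trans s0)// ltW.
have [ut|tu] := leP u t.
  rewrite (_ : [set w | _] = setT); first exact: (filtrationT HF).
  apply/seteqP; split => w //= _; rewrite /extend_stop; case: ifPn => _.
    by rewrite lee_fin.
  by rewrite (le_trans (tau_le w))// lee_fin (le_trans _ ut)// ltW.
have -> : [set w | (extend_stop tau A u w <= t%:E)%E] =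
    [set w | (tau w <= t%:E)%E] `&` ~` A.
  apply/seteqP; split => w /=; rewrite /extend_stop; case: ifPn.
  - by rewrite lee_fin leNgt tu.
  - by rewrite notin_setE.
  - by rewrite inE => ? [].
  - by move=> _ [].
have [st|ts] := leP s t.
  apply: (filtrationI HF) => //; first exact: tauF.
  by apply: (filtrationC HF) => //; exact: (filtration_mono HF s0 st).
rewrite (_ : _ `&` _ = [set w | (tau w <= t%:E)%E]); first exact: tauF.
apply/seteqP; split => w /=; first by case.
by move=> h; split => // Aw; move: h; rewrite tauA// lee_fin leNgt ts.
Qed.

Lemma extend_stop_le w : (extend_stop tau A u w <= u%:E)%E.
Proof.
rewrite /extend_stop; case: ifPn => // _.
by rewrite (le_trans (tau_le w))// lee_fin ltW.
Qed.

Lemma extend_stop_in w : A w -> extend_stop tau A u w = u%:E.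
Proof. by move=> Aw; rewrite /extend_stop mem_set. Qed.

Lemma extend_stop_return :
  \int[Q]_(z in until (extend_stop tau A u)) payoff z =
  \int[Q]_(z in until tau) payoff z +
  (expR (- (alpha * s)) * \int[P]_(w in A) perpetuity (state s w) -
   expR (- (alpha * u)) * \int[P]_(w in A) perpetuity (state u w)).
Proof.
have mA := filtration_measurable_set HF s0 FA.
rewrite -payoff_slab//.
have -> : until (extend_stop tau A u) = until tau `|` slab A s u.
  apply/seteqP; split => -[w t]; rewrite /until/slab/extend_stop/=.
    case: ifPn => [|_ [? ?]]; last by left.
    rewrite inE => Aw [t0]; rewrite lee_fin => tu.
    have [ts|st] := leP (t : R) s; last by right.
    by left; rewrite tauA.
  move=> [[t0 tt]|[Aw /andP[st tu]]].
    by split => //; case: ifPn => // _; rewrite (le_trans tt)// (le_trans (tau_le w))// lee_fin ltW.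
  by rewrite mem_set//; split; rewrite ?lee_fin// (le_trans s0)// ltW.
have mT := measurable_until HF st_tau; have mS := measurable_slab s u mA.
rewrite Rintegral_setU//.
- apply: (integrable_payoff_on HF HB sigma x nu alpha0).
    exact: measurableU.
  by move=> z [[]//|/(slab_nonneg s0)].
- apply/disj_setPS => -[w t] [[_ /= tt] [Aw /andP[st _]]].
  by move: tt; rewrite tauA// lee_fin leNgt st.
Qed.

End extend.
End extension.

(** * Monotonicity of the exponents and of the threshold *)

Section thresholds_monotone.
Variable R : realType.
Implicit Types alpha sigma nu : R.

Local Notation rad alpha sigma nu := (Num.sqrt (nu ^+ 2 + 2 * alpha * sigma ^+ 2)).

Lemma rad_gt0 alpha sigma nu : 0 < alpha -> 0 < sigma ->
  0 < nu ^+ 2 + 2 * alpha * sigma ^+ 2.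
Proof. by move=> a0 s0; rewrite ltr_wpDl ?sqr_ge0// !mulr_gt0// exprn_gt0. Qed.

Lemma normr_lt_rad alpha sigma nu : 0 < alpha -> 0 < sigma ->
  `|nu| < rad alpha sigma nu.
Proof.
move=> a0 s0; rewrite -sqrtr_sqr ltr_sqrt ?rad_gt0// ltrDl.
by rewrite !mulr_gt0// exprn_gt0.
Qed.

Lemma sqr_rad alpha sigma nu : 0 < alpha -> 0 < sigma ->
  rad alpha sigma nu ^+ 2 = nu ^+ 2 + 2 * alpha * sigma ^+ 2.
Proof. by move=> a0 s0; rewrite sqr_sqrtr// ltW// rad_gt0. Qed.

Lemma rad_bounds alpha sigma nu : 0 < alpha -> 0 < sigma ->
  0 < rad alpha sigma nu - nu /\ 0 < rad alpha sigma nu + nu.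
Proof.
move=> a0 s0; have := normr_lt_rad nu a0 s0.
by rewrite ltr_norml => /andP[h1 h2]; split; lra.
Qed.

(** Conjugate form, in which the numerator is free of [sigma]. *)
Lemma psiE alpha sigma nu : 0 < alpha -> 0 < sigma ->
  psi alpha sigma nu = 2 * alpha / (rad alpha sigma nu + nu).
Proof.
move=> a0 s0; have [_ h] := rad_bounds nu a0 s0.
have e := sqr_rad nu a0 s0; rewrite /psi; set r := Num.sqrt _ in h e *.
have s2 : sigma ^+ 2 != 0 by rewrite expf_neq0// gt_eqF.
apply/eqP; rewrite eqr_div ?(gt_eqF h)//; apply/eqP; nra.
Qed.

Lemma phiE alpha sigma nu : 0 < alpha -> 0 < sigma ->
  phi alpha sigma nu = - (2 * alpha / (rad alpha sigma nu - nu)).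
Proof.
move=> a0 s0; have [h _] := rad_bounds nu a0 s0.
have e := sqr_rad nu a0 s0; rewrite /phi; set r := Num.sqrt _ in h e *.
have s2 : sigma ^+ 2 != 0 by rewrite expf_neq0// gt_eqF.
rewrite -mulNr; apply/eqP; rewrite eqr_div ?(gt_eqF h)//; apply/eqP; nra.
Qed.

Lemma psi_gt0 alpha sigma nu : 0 < alpha -> 0 < sigma -> 0 < psi alpha sigma nu.
Proof.
move=> a0 s0; have [_ h] := rad_bounds nu a0 s0.
by rewrite psiE// divr_gt0// mulr_gt0.
Qed.

Lemma xiE alpha sigma nu : 0 < alpha -> 0 < sigma ->
  xi alpha sigma nu = - (psi alpha sigma nu)^-1.
Proof.
move=> a0 s0; have [h _] := rad_bounds nu a0 s0.
rewrite /xi /psi invf_div -mulrN -invrN; congr (_ / _); ring.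
Qed.

Lemma rad_sigma_lt alpha sigma1 sigma2 nu : 0 < alpha -> 0 < sigma1 ->
  sigma1 < sigma2 -> rad alpha sigma1 nu < rad alpha sigma2 nu.
Proof.
move=> a0 s0 s12; have s20 := lt_trans s0 s12.
rewrite ltr_sqrt ?rad_gt0// ltrD2l ltr_pM2l ?mulr_gt0// ltr_pXn2r// nnegrE ltW//.
Qed.

Lemma rad_alpha_lt alpha1 alpha2 sigma nu : 0 < alpha1 -> alpha1 < alpha2 ->
  0 < sigma -> rad alpha1 sigma nu < rad alpha2 sigma nu.
Proof.
move=> a0 a12 s0; have a20 := lt_trans a0 a12.
by rewrite ltr_sqrt ?rad_gt0// ltrD2l ltr_pM2r ?exprn_gt0// ltr_pM2l.
Qed.

(** [rad] is a norm of the vector made of the drift and of a fixed nonzero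
    second coordinate, hence strictly contracting in the drift. *)
Lemma rad_nu_lt alpha sigma nu1 nu2 : 0 < alpha -> 0 < sigma -> nu1 < nu2 ->
  `|rad alpha sigma nu1 - rad alpha sigma nu2| < nu2 - nu1.
Proof.
move=> a0 s0 n12.
have [m1 p1] := rad_bounds nu1 a0 s0; have [m2 p2] := rad_bounds nu2 a0 s0.
have e1 := sqr_rad nu1 a0 s0; have e2 := sqr_rad nu2 a0 s0.
set r1 := Num.sqrt (nu1 ^+ 2 + _) in m1 p1 e1 *.
set r2 := Num.sqrt (nu2 ^+ 2 + _) in m2 p2 e2 *.
have e : (r1 - r2) * (r1 + r2) = (nu1 - nu2) * (nu1 + nu2) by lra.
rewrite ltr_norml; apply/andP; split; nra.
Qed.

Lemma psi_sigma_lt alpha sigma1 sigma2 nu :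
  0 < alpha -> 0 < sigma1 -> sigma1 < sigma2 ->
  psi alpha sigma2 nu < psi alpha sigma1 nu.
Proof.
move=> a0 s0 s12; have s20 := lt_trans s0 s12.
have [_ h1] := rad_bounds nu a0 s0; have [_ h2] := rad_bounds nu a0 s20.
rewrite !psiE// ltr_pM2l ?mulr_gt0// ltf_pV2// ltrD2r; exact: rad_sigma_lt.
Qed.

Lemma psi_nu_lt alpha sigma nu1 nu2 :
  0 < alpha -> 0 < sigma -> nu1 < nu2 -> psi alpha sigma nu2 < psi alpha sigma nu1.
Proof.
move=> a0 s0 n12; have := rad_nu_lt a0 s0 n12; rewrite ltr_norml => /andP[h1 h2].
rewrite /psi ltr_pM2r ?invr_gt0 ?exprn_gt0//; lra.
Qed.

Lemma psi_alpha_lt alpha1 alpha2 sigma nu :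
  0 < alpha1 -> alpha1 < alpha2 -> 0 < sigma ->
  psi alpha1 sigma nu < psi alpha2 sigma nu.
Proof.
move=> a0 a12 s0; rewrite /psi ltr_pM2r ?invr_gt0 ?exprn_gt0// ltrD2l.
exact: rad_alpha_lt.
Qed.

Lemma phi_sigma_lt alpha sigma1 sigma2 nu :
  0 < alpha -> 0 < sigma1 -> sigma1 < sigma2 ->
  phi alpha sigma1 nu < phi alpha sigma2 nu.
Proof.
move=> a0 s0 s12; have s20 := lt_trans s0 s12.
have [h1 _] := rad_bounds nu a0 s0; have [h2 _] := rad_bounds nu a0 s20.
rewrite !phiE// ltrN2 ltr_pM2l ?mulr_gt0// ltf_pV2// ltrD2r; exact: rad_sigma_lt.
Qed.

Lemma phi_nu_lt alpha sigma nu1 nu2 :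
  0 < alpha -> 0 < sigma -> nu1 < nu2 -> phi alpha sigma nu2 < phi alpha sigma nu1.
Proof.
move=> a0 s0 n12; have := rad_nu_lt a0 s0 n12; rewrite ltr_norml => /andP[h1 h2].
rewrite /phi ltr_pM2r ?invr_gt0 ?exprn_gt0//; lra.
Qed.

Lemma phi_alpha_lt alpha1 alpha2 sigma nu :
  0 < alpha1 -> alpha1 < alpha2 -> 0 < sigma ->
  phi alpha2 sigma nu < phi alpha1 sigma nu.
Proof.
move=> a0 a12 s0; rewrite /phi ltr_pM2r ?invr_gt0 ?exprn_gt0// ltrD2l ltrN2.
exact: rad_alpha_lt.
Qed.

Lemma xi_lt_of_psi alpha1 alpha2 sigma1 sigma2 nu1 nu2 :
  0 < alpha1 -> 0 < alpha2 -> 0 < sigma1 -> 0 < sigma2 ->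
  psi alpha1 sigma1 nu1 < psi alpha2 sigma2 nu2 ->
  xi alpha1 sigma1 nu1 < xi alpha2 sigma2 nu2.
Proof. by move=> *; rewrite !xiE// ltrN2 ltf_pV2 ?posrE ?psi_gt0. Qed.

Lemma xi_lt0 alpha sigma nu : 0 < alpha -> 0 < sigma -> xi alpha sigma nu < 0.
Proof. by move=> a0 s0; rewrite xiE// oppr_lt0 invr_gt0 psi_gt0. Qed.

End thresholds_monotone.

(** * Choice of the barrier, of the exponent and of the time step *)

Section barrier.
Variable R : realType.
Variables alpha sigma nu : R.
Hypotheses (alpha0 : 0 < alpha) (sigma0 : 0 < sigma) (nu0 : nu < 0).

(** With [p = - phi], the identity [xi = - 1 / p - nu / alpha] turns [b > xi] into
    [alpha g < 1 / p], so that an exponent [K] fits strictly between [p] and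
    [1 / (alpha g)]; the last inequality holds because its quadratic in [K]
    vanishes at [p] and increases beyond. *)
Lemma barrier_exists (y : R) : xi alpha sigma nu < y -> y <= 0 ->
  exists b K g : R, [/\ b < y, 0 < K, 0 < g, g = - (b / alpha + nu / alpha ^+ 2)
    & alpha * g * K < 1 /\ 0 < sigma ^+ 2 * K ^+ 2 / 2 - nu * K - alpha].
Proof.
move=> xy y0; have [h1 h2] := rad_bounds nu alpha0 sigma0.
have e := sqr_rad nu alpha0 sigma0; have xE : xi alpha sigma nu =
    - ((Num.sqrt (nu ^+ 2 + 2 * alpha * sigma ^+ 2) + nu) / (2 * alpha)).
  by rewrite xiE// psiE// invf_div.
set r := Num.sqrt _ in h1 h2 e xE.
pose z := xi alpha sigma nu; pose b := (z + y) / 2.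
have zb : z < b by rewrite /b; have : z < y by []; lra.
have by_ : b < y by rewrite /b; have : z < y by []; lra.
have b0 : b < 0 by lra.
have nua : nu / alpha < 0 by rewrite ltr_pdivrMr// mul0r.
pose ag := - b - nu / alpha.
have ag0 : 0 < ag by rewrite /ag; lra.
pose p := 2 * alpha / (r - nu).
have p0 : 0 < p by rewrite divr_gt0// mulr_gt0.
have pr : p * (r - nu) = 2 * alpha by rewrite divfK// gt_eqF.
have agp : ag < p^-1.
  have -> : p^-1 = - z - nu / alpha.
    by rewrite invf_div /z xE; field; rewrite gt_eqF.
  by rewrite /ag; lra.
have pag : p < ag^-1 by rewrite -[p]invrK ltf_pV2 ?posrE// invr_gt0.
pose K := (p + ag^-1) / 2.
have pK : p < K by rewrite /K; lra.
have Kag : K < ag^-1 by rewrite /K; lra.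
exists b, K, (ag / alpha); split => //.
- exact: lt_trans pK.
- by rewrite divr_gt0.
- by rewrite /ag; field; rewrite gt_eqF.
split.
  by rewrite [alpha * _]mulrC divfK ?gt_eqF// -ltr_pdivlMl// mulr1.
have ps : p * sigma ^+ 2 = r + nu.
  have : (p * sigma ^+ 2) * (r - nu) = (r + nu) * (r - nu).
    by rewrite mulrAC pr; nra.
  by move/(mulIf _); apply; rewrite gt_eqF.
have -> : sigma ^+ 2 * K ^+ 2 / 2 - nu * K - alpha =
    (K - p) * (sigma ^+ 2 * (K + p) / 2 - nu).
  have e3 : p * (p * sigma ^+ 2) = p * (r + nu) by rewrite ps.
  have : p * (p * sigma ^+ 2) - p * (r + nu) = 0 by rewrite e3 subrr.
  lra.
rewrite mulr_gt0 ?subr_gt0//.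
have : 0 < sigma ^+ 2 * (K + p).
  by rewrite mulr_gt0 ?exprn_gt0// addr_gt0//; exact: lt_trans pK.
by move=> h; rewrite (lt_trans nu0)// divr_gt0.
Qed.

(** A positive step [h] and a tilt [L] for which the value that can be lost by
    overshooting the barrier during one step is dominated by the strict
    subharmonicity gained over that step.  With [h = e ^ 2] and [L = e ^ -1] the
    loss is of order [exp (- s0 / e)] and the gain of order [e ^ 2]. *)
Lemma small_step_exists (K s0 : R) : 0 < K -> 0 < s0 ->
  0 < sigma ^+ 2 * K ^+ 2 / 2 - nu * K - alpha ->
  exists h L : R, [/\ 0 < h, 0 <= L &
   expR (- (alpha * h) - L * s0 - (K + L) * nu * h + (K + L) ^+ 2 * sigma ^+ 2 * h / 2)
   <= expR ((sigma ^+ 2 * K ^+ 2 / 2 - nu * K - alpha) * h) - 1].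
Proof.
move=> K0 s00; set lam := _ - alpha => lam0.
pose M := (K + 1) * - nu + (K + 1) ^+ 2 * sigma ^+ 2 / 2.
(* e is chosen so that exp M times the cubic bound (3 e / s0) ^ 3 on
   exp (- s0 / e) is at most lam e ^ 2 *)
pose e := Num.min 1 (lam * s0 ^+ 3 / (27 * expR M)).
have e0 : 0 < e by rewrite lt_min ltr01 divr_gt0 ?mulr_gt0 ?exprn_gt0 ?expR_gt0.
have e1 : e <= 1 by rewrite ge_min lexx.
have eM : e * (27 * expR M) <= lam * s0 ^+ 3.
  by rewrite -ler_pdivlMr ?mulr_gt0 ?expR_gt0// ge_min lexx orbT.
exists (e ^+ 2), e^-1; split; first exact: exprn_gt0; first by rewrite invr_ge0 ltW.
apply: (@le_trans _ _ (lam * e ^+ 2)); last first.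
  by have := expR_ge1Dx (lam * e ^+ 2); lra.
apply: (@le_trans _ _ (expR M * expR (- (s0 / e)))).
  rewrite -expRD ler_expR.
  have en : e^-1 * e = 1 by rewrite mulVf// gt_eqF.
  have -> : (K + e^-1) * nu * e ^+ 2 = (K * e + 1) * nu * e.
    by rewrite -[in RHS]en; ring.
  have -> : (K + e^-1) ^+ 2 * sigma ^+ 2 * e ^+ 2 = (K * e + 1) ^+ 2 * sigma ^+ 2.
    by rewrite -[in RHS]en; ring.
  have Ke : K * e <= K by rewrite ler_piMr// ltW.
  have Ke0 : 0 <= K * e by rewrite mulr_ge0 ?ltW.
  have h1 : (K * e + 1) ^+ 2 * sigma ^+ 2 <= (K + 1) ^+ 2 * sigma ^+ 2.
    by rewrite ler_wpM2r ?sqr_ge0// ler_pXn2r// ?nnegrE ?lerD2r//; lra.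
  have h2 : - ((K * e + 1) * nu * e) <= (K + 1) * - nu.
    have -> : - ((K * e + 1) * nu * e) = (K * e + 1) * e * - nu by ring.
    apply: ler_wpM2r; first by rewrite oppr_ge0 ltW.
    by apply: (@le_trans _ _ (K * e + 1)); [rewrite ler_piMr//|]; lra.
  have h3 : 0 <= alpha * e ^+ 2 by rewrite mulr_ge0 ?sqr_ge0 ?ltW.
  by rewrite /M [e^-1 * s0]mulrC; lra.
pose v := s0 / e / 3.
have v0 : 0 < v by rewrite !divr_gt0.
have h3v : v ^+ 3 <= expR (s0 / e).
  have -> : s0 / e = 3%:R * v by rewrite /v; field; rewrite gt_eqF.
  rewrite expRM_natl ler_pXn2r ?nnegrE ?expR_ge0 ?ltW//.
  by have := expR_ge1Dx v; lra.
rewrite expRN ler_pdivrMr ?expR_gt0//.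
apply: le_trans (_ : lam * e ^+ 2 * v ^+ 3 <= _); last by rewrite ler_pM2l ?mulr_gt0 ?exprn_gt0.
have -> : lam * e ^+ 2 * v ^+ 3 = lam * s0 ^+ 3 / (27 * e).
  by rewrite /v; field; rewrite gt_eqF.
by rewrite ler_pdivlMr ?mulr_gt0//; lra.
Qed.

End barrier.

(** * The one-step inequality *)

Section barrier_value.
Variable R : realType.
Variables alpha nu b K g : R.
Hypotheses (alpha0 : 0 < alpha) (K0 : 0 < K) (g0 : 0 < g).
Hypothesis gE : g = - perpetuity alpha nu b.
Hypothesis gK : alpha * g * K < 1.

Definition barrier_value (z : R) : R := perpetuity alpha nu z + g * expR (K * (b - z)).

Lemma barrier_valueE z : barrier_value z = (z - b) / alpha - g + g * expR (K * (b - z)).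
Proof.
rewrite /barrier_value; congr (_ + _).
by rewrite [in RHS]gE /perpetuity; ring.
Qed.

Lemma barrier_slope_gt0 : 0 < alpha^-1 - g * K.
Proof. by rewrite subr_gt0 -(ltr_pM2l alpha0) mulfV ?gt_eqF// mulrA. Qed.

Lemma barrier_value_ge z : b <= z -> (alpha^-1 - g * K) * (z - b) <= barrier_value z.
Proof.
move=> bz; rewrite barrier_valueE.
have h := expR_ge1Dx (K * (b - z)).
have : g * (1 + K * (b - z)) <= g * expR (K * (b - z)) by rewrite ler_pM2l.
lra.
Qed.

Lemma barrier_value_le z : b <= z -> barrier_value z <= (z - b) / alpha.
Proof.
move=> bz; rewrite barrier_valueE.
have : g * expR (K * (b - z)) <= g.
  apply: ler_piMr; first exact: ltW.
  by rewrite expR_le1 pmulr_rle0// subr_le0.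
lra.
Qed.

(** The distance below [b] within which [barrier_value] stays nonpositive, as
    given by the slope bound [exp v - 1 <= v exp v]. *)
Definition barrier_width : R := - (ln (alpha * g * K) / K).

Lemma barrier_width_gt0 : 0 < barrier_width.
Proof.
rewrite /barrier_width oppr_gt0 pmulr_llt0 ?invr_gt0// ln_lt0// gK andbT.
by rewrite !mulr_gt0.
Qed.

Lemma expR_barrier_width : g * K * expR (K * barrier_width) = alpha^-1.
Proof.
have agK : 0 < alpha * g * K by rewrite !mulr_gt0.
have -> : K * barrier_width = - ln (alpha * g * K).
  by rewrite /barrier_width; field; rewrite gt_eqF.
by rewrite expRN lnK ?posrE//; field; rewrite !gt_eqF.
Qed.

(** An exponential bound valid over the whole half-line below [b]: within
    [barrier_width] of [b] the left-hand side is nonpositive, and beyond it the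
    factor of exponent [L] is at least one. It allows the contribution of
    overshooting to be computed by exponential moments, without any estimate of
    Gaussian tails. *)
Lemma barrier_value_overshoot (L z : R) : 0 <= L -> z <= b ->
  barrier_value z <= g * expR ((K + L) * (b - z) - L * barrier_width).
Proof.
move=> L0 zb; set w := barrier_width; rewrite barrier_valueE.
have s0 : 0 <= b - z by rewrite subr_ge0.
have [sw|ws] := leP (b - z) w.
  apply: (@le_trans _ _ 0); last by rewrite mulr_ge0 ?expR_ge0 ?ltW.
  have h := expR_ge1Dx (- (K * (b - z))).
  have e1 : expR (K * (b - z)) * expR (- (K * (b - z))) = 1 by rewrite -expRD subrr expR0.
  have e2 : expR (K * (b - z)) <= expR (K * w) by rewrite ler_expR ler_pM2l.
  have e3 : expR (K * (b - z)) - 1 <= K * (b - z) * expR (K * (b - z)).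
    have := expR_gt0 (K * (b - z)); nra.
  have e4 : K * (b - z) * expR (K * (b - z)) <= K * (b - z) * expR (K * w).
    by rewrite ler_wpM2l// mulr_ge0// ltW.
  have e5 : g * (expR (K * (b - z)) - 1) <= (b - z) * (g * K * expR (K * w)).
    have := ler_wpM2l (ltW g0) (le_trans e3 e4); lra.
  rewrite expR_barrier_width in e5; lra.
apply: (@le_trans _ _ (g * expR (K * (b - z)))).
  have hz : (z - b) / alpha <= 0 by rewrite pmulr_lle0 ?invr_gt0// subr_le0.
  by rewrite gerDr subr_le0 (le_trans hz)// ltW.
by rewrite ler_pM2l// ler_expR mulrDl -addrA lerDl -mulrBr mulr_ge0// subr_ge0 ltW.
Qed.

End barrier_value.

Section grid_strategy.
Context d (Omega : measurableType d) (R : realType) (P : probability Omega R).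
Variables (F : R -> set_system Omega) (B : R -> {RV P >-> R}).
Hypotheses (HF : filtration F) (HB : brownian_motion F B).
Variables alpha sigma x nu : R.
Hypotheses (alpha0 : 0 < alpha) (sigma0 : 0 < sigma).
Local Notation X := (state B sigma x nu).

Let expXE (q b t : R) w :
  expR (q * (b - X t w)) = expR (q * (b - x - nu * t)) * expR (- (q * sigma) * B t w).
Proof. by rewrite -expRD /state; congr expR; ring. Qed.

Lemma integrable_expX (q b t : R) (A : set Omega) : 0 <= t -> measurable A ->
  P.-integrable A (EFin \o (fun w => expR (q * (b - X t w)))).
Proof.
move=> t0 mA; rewrite [EFin \o _](_ : _ = fun w =>
    (expR (q * (b - x - nu * t)))%:E * (expR (- (q * sigma) * B t w))%:E)%E; last first.
  by apply/funext => w /=; rewrite expXE.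
apply: integrableZl => //; apply: (integrableS measurableT) => //.
exact: (integrable_expB HF HB).
Qed.

Lemma Rintegral_expX_step (q b s u : R) (A : set Omega) :
  0 <= s -> s <= u -> F s A ->
  \int[P]_(w in A) expR (q * (b - X u w)) =
  (\int[P]_(w in A) expR (q * (b - X s w))) *
  expR (- (q * nu * (u - s)) + q ^+ 2 * sigma ^+ 2 * (u - s) / 2).
Proof.
move=> s0 su FA; have mA := filtration_measurable_set HF s0 FA.
have iB c t : 0 <= t -> P.-integrable A (EFin \o (fun w => expR (c * B t w))).
  by move=> t0; apply: (integrableS measurableT) => //; exact: (integrable_expB HF HB).
under eq_Rintegral do rewrite expXE.
under [X in _ = X * _]eq_Rintegral do rewrite expXE.
rewrite !RintegralZl//; [|exact: iB|by apply: iB; exact: le_trans su].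
rewrite (Rintegral_expB_step HF HB _ s0 su FA); set I := Rintegral _ _ _.
by rewrite mulrCA [_ * I]mulrC -[RHS]mulrA -!expRD; congr (I * expR _); field.
Qed.

Variables b K g h L : R.
Hypotheses (K0 : 0 < K) (g0 : 0 < g) (gE : g = - perpetuity alpha nu b).
Hypotheses (gK : alpha * g * K < 1) (h0 : 0 < h) (L0 : 0 <= L).
Hypothesis small_step :
  expR (- (alpha * h) - L * barrier_width alpha K g - (K + L) * nu * h +
        (K + L) ^+ 2 * sigma ^+ 2 * h / 2)
  <= expR ((sigma ^+ 2 * K ^+ 2 / 2 - nu * K - alpha) * h) - 1.
Local Notation W := (barrier_value alpha nu b K g).

Lemma integrable_perpetuity t A : 0 <= t -> measurable A ->
  P.-integrable A (EFin \o (fun w => perpetuity alpha nu (X t w))).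
Proof.
move=> t0 mA; have iX := integrable_state HF HB sigma x nu t0 mA.
have := integrableD mA (integrableZr mA alpha^-1 iX)
  (finite_measure_integrable_cst P (nu / alpha ^+ 2) mA).
exact.
Qed.

Lemma integrable_barrier_value t A : 0 <= t -> measurable A ->
  P.-integrable A (EFin \o (fun w => W (X t w))).
Proof.
move=> t0 mA; exact: (integrableD mA (integrable_perpetuity t0 mA)
  (integrableZl mA g (integrable_expX K b t0 mA))).
Qed.

Lemma adapted_state_ge (t : R) : 0 <= t -> F t [set w | b <= X t w].
Proof.
move=> t0; rewrite [X in F t X](_ : _ = [set w | (b - x - nu * t) / sigma <= B t w]).
  exact: (adapted_ge HB).
apply/seteqP; split => w /=; rewrite /state ler_pdivrMr// [B t w * _]mulrC => ?; lra.
Qed.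

(** The right-hand side is the return of one more step on [A]. The inequality says
    that it pays for the decrease of the potential [W], where the potential is
    lost on the paths that leave the half-line above [b]. *)
Lemma grid_step (s u : R) (A A' : set Omega) : 0 <= s -> F s A ->
  (forall w, A w -> b <= X s w) ->
  u = s + h -> A' = A `&` [set w | b <= X u w] ->
  expR (- (alpha * s)) * \int[P]_(w in A) W (X s w) -
  expR (- (alpha * u)) * \int[P]_(w in A') W (X u w) <=
  expR (- (alpha * s)) * \int[P]_(w in A) perpetuity alpha nu (X s w) -
  expR (- (alpha * u)) * \int[P]_(w in A) perpetuity alpha nu (X u w).
Proof.
move=> s0 FA bX uE A'E.
have su : s <= u by rewrite uE lerDl ltW.
have u0 : 0 <= u by exact: le_trans su.
have us : u - s = h by rewrite uE addrC addKr.
have mA := filtration_measurable_set HF s0 FA.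
have mbX : measurable [set w | b <= X u w].
  exact: (filtration_measurable_set HF u0 (adapted_state_ge u0)).
have hst := small_step; set wd := barrier_width alpha K g in hst.
pose over w := expR ((K + L) * (b - X u w)).
have iover : P.-integrable A (EFin \o over) by exact: integrable_expX.
(* dropping the paths below b costs at most the exponential moment of over *)
have WA' : \int[P]_(w in A) W (X u w) - g * expR (- (L * wd)) * \int[P]_(w in A) over w
    <= \int[P]_(w in A') W (X u w).
  rewrite A'E Rintegral_mkcondr -RintegralZl// -RintegralB//; last 2 first.
  - exact: integrable_barrier_value.
  - exact: (integrableZl mA (g * expR (- (L * wd))) iover).
  apply: le_Rintegral => //.
  - exact: (integrableB mA (integrable_barrier_value u0 mA)
      (integrableZl mA (g * expR (- (L * wd))) iover)).
  - rewrite -restrict_EFin; apply/integrable_restrict => //.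
    by apply: integrable_barrier_value => //; exact: measurableI.
  move=> w Aw; rewrite patchE; case: ifPn => [|/negP]; rewrite inE/= => bu.
    by rewrite gerBl mulr_ge0 ?mulr_ge0 ?expR_ge0 ?ltW.
  rewrite subr_le0 -mulrA -expRD addrC; apply: barrier_value_overshoot => //.
  by rewrite leNgt; apply/negP => h1; apply: bu; exact: ltW.
have RW t : 0 <= t -> \int[P]_(w in A) W (X t w) =
    \int[P]_(w in A) perpetuity alpha nu (X t w) + g * \int[P]_(w in A) expR (K * (b - X t w)).
  move=> t0; rewrite RintegralD//; first by rewrite RintegralZl//; exact: integrable_expX.
    exact: integrable_perpetuity.
  exact: (integrableZl mA g (integrable_expX K b t0 mA)).
move: WA'; rewrite (RW s s0) (RW u u0) /over.
rewrite (Rintegral_expX_step K b s0 su FA) (Rintegral_expX_step (K + L) b s0 su FA) us.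
set EK := \int[P]_(w in A) expR (K * (b - X s w)).
set EL := \int[P]_(w in A) expR ((K + L) * (b - X s w)).
have EK0 : 0 <= EK by apply: Rintegral_ge0 => w _; exact: expR_ge0.
have EL0 : 0 <= EL by apply: Rintegral_ge0 => w _; exact: expR_ge0.
have ELK : EL <= EK.
  apply: le_Rintegral => //; [exact: integrable_expX..|].
  move=> w Aw; rewrite ler_expR; apply: ler_wnM2r; first by rewrite subr_le0 bX.
  by rewrite lerDl.
set ps := \int[P]_(w in A) perpetuity alpha nu (X s w).
set pu := \int[P]_(w in A) perpetuity alpha nu (X u w).
set I' := \int[P]_(w in A') W (X u w).
set ek := expR (- (K * nu * h) + _); set el := expR (- ((K + L) * nu * h) + _).
move=> hI.
have -> : expR (- (alpha * u)) = expR (- (alpha * s)) * expR (- (alpha * h)).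
  by rewrite -expRD uE; congr expR; ring.
set a := expR (- (alpha * s)); have a0 : 0 < a by exact: expR_gt0.
set dh := expR (- (alpha * h)); have dh0 : 0 < dh by exact: expR_gt0.
have dek : dh * ek = expR ((sigma ^+ 2 * K ^+ 2 / 2 - nu * K - alpha) * h).
  by rewrite -expRD; congr expR; field.
have del : dh * (expR (- (L * wd)) * el) <= dh * ek - 1.
  rewrite dek; apply: le_trans hst; rewrite /dh /el -!expRD ler_expR.
  by rewrite le_eqVlt; apply/orP; left; apply/eqP; ring.
have T0 : 0 <= dh * (expR (- (L * wd)) * el) by rewrite !mulr_ge0 ?expR_ge0.
have h1 : dh * (expR (- (L * wd)) * el) * EL <= (dh * ek - 1) * EK.
  by apply: ler_pM.
have h2 := ler_wpM2l (ltW dh0) hI.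
have h3 := ler_wpM2l (ltW g0) h1.
have h4 : ps + g * EK - dh * I' <= ps - dh * pu by lra.
have := ler_wpM2l (ltW a0) h4; lra.
Qed.

End grid_strategy.

(** * Strategies that beat the deterministic one *)

Section strategies.
Context d (Omega : measurableType d) (R : realType) (P : probability Omega R).
Variables (F : R -> set_system Omega) (B : R -> {RV P >-> R}).
Hypotheses (HF : filtration F) (HB : brownian_motion F B).
Local Notation leb := (@lebesgue_measure R).
Local Notation Q := (P \x leb)%E.
Variable alpha : R.
Hypothesis alpha0 : 0 < alpha.

Definition expected_payoff (sigma x nu : R) (tau : Omega -> \bar R) : R :=
  \int[Q]_(z in until tau) payoff B alpha sigma x nu z.

Lemma stopping_time_cst (t : R) : 0 <= t -> stopping_time F (fun=> t%:E).
Proof.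
move=> t0; split => [w|s s0]; first by rewrite lee_fin.
have [ts|st] := leP t s.
  rewrite (_ : [set _ | _] = setT); first exact: (filtrationT HF).
  by apply/seteqP; split => w //= _; rewrite lee_fin.
rewrite (_ : [set _ | _] = ~` setT).
  by apply: (filtrationC HF) => //; exact: (filtrationT HF).
by rewrite setCT; apply/seteqP; split => w //=; rewrite lee_fin leNgt st.
Qed.

Let PT : fine (P setT) = 1. Proof. by have /= -> := probability_setT P. Qed.

Let B0 : \int[P]_w B 0 w = 0.
Proof.
under eq_Rintegral do rewrite (bm_start HB).
by rewrite Rintegral_cst// mul0r.
Qed.

Lemma mean_state (sigma x nu t : R) : 0 <= t ->
  \int[P]_w state B sigma x nu t w = x + nu * t.
Proof.
move=> t0; rewrite (Rintegral_state HF HB sigma x nu (lexx 0) t0 (filtrationT HF (lexx 0))).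
by rewrite PT B0 mul1r mulr0 addr0.
Qed.

Lemma expected_payoff_cst (sigma x nu t : R) : 0 <= t ->
  expected_payoff sigma x nu (fun=> t%:E) =
  perpetuity alpha nu x - expR (- (alpha * t)) * perpetuity alpha nu (x + nu * t).
Proof.
move=> t0; have J0 : expected_payoff sigma x nu (fun=> 0%:E) = 0.
  apply/EFin_inj; rewrite -(discounted_returnE HF HB sigma x nu alpha0 (stopping_time_cst (lexx 0))).
  apply: integral0_eq => w _.
  rewrite (_ : [set _ | _] = [set 0]); first by rewrite integral_set1.
  apply/seteqP; split => s /=; rewrite !lee_fin.
    by move=> /andP[s0 s1]; apply/le_anti; rewrite s0 s1.
  by move=> ->; rewrite lexx.
move: t0; rewrite le_eqVlt => /predU1P[<-|t0].
  by rewrite J0 !mulr0 oppr0 expR0 mul1r addr0 subrr.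
have E s : 0 <= s -> \int[P]_w perpetuity alpha nu (state B sigma x nu s w) =
    perpetuity alpha nu (x + nu * s).
  move=> s0; rewrite (Rintegral_perpetuity HF HB alpha sigma x nu (lexx 0) s0 (filtrationT HF (lexx 0))).
  by rewrite PT B0 /perpetuity !mul1r mulr0 addr0.
have := extend_stop_return HF HB sigma x nu alpha0 (lexx 0) t0
  (filtrationT HF (lexx 0)) (stopping_time_cst (lexx 0)) (fun=> lexx _) (fun _ _ => erefl _).
rewrite (_ : extend_stop _ _ _ = fun=> t%:E); last first.
  by apply/funext => w; rewrite extend_stop_in.
rewrite -/(expected_payoff sigma x nu _) => ->.
rewrite -/(expected_payoff sigma x nu _) J0 (E 0 (lexx 0)) (E t (ltW t0)).
by rewrite !mulr0 oppr0 expR0 mul1r addr0 add0r.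
Qed.

(** The payoff is jointly affine in the volatility and the drift. *)
Lemma expected_payoff_affine (l s0 s1 s2 n0 n1 n2 x : R) (tau : Omega -> \bar R) :
  stopping_time F tau ->
  s1 = l * s0 + (1 - l) * s2 -> n1 = l * n0 + (1 - l) * n2 ->
  expected_payoff s1 x n1 tau =
  l * expected_payoff s0 x n0 tau + (1 - l) * expected_payoff s2 x n2 tau.
Proof.
move=> st -> ->; have mD := measurable_until HF st.
have ii s n := integrable_payoff_on HF HB s x n alpha0 mD (fun z => @proj1 _ _).
rewrite /expected_payoff -!RintegralZl// -RintegralD//; last 2 first.
- exact: (integrableZl mD l (ii s0 n0)).
- exact: (integrableZl mD (1 - l) (ii s2 n2)).
by apply: eq_Rintegral => z _; rewrite /payoff; ring.
Qed.

Lemma deterministic_optimal (x nu : R) (tau : Omega -> \bar R) : nu < 0 ->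
  stopping_time F tau ->
  expected_payoff 0 x nu tau <= expected_payoff 0 x nu (fun=> (Num.max 0 (- x / nu))%:E).
Proof.
move=> nu0 st; set t0 := Num.max _ _.
have t00 : 0 <= t0 by rewrite le_max lexx.
have mD := measurable_until HF st.
have mD0 := measurable_until HF (stopping_time_cst t00).
have ii D (mD' : measurable D) := integrable_payoff_on HF HB 0 x nu alpha0 mD'.
have i1 := ii _ mD (fun z => @proj1 _ _); have i2 := ii _ mD0 (fun z => @proj1 _ _).
rewrite /expected_payoff Rintegral_mkcond [leRHS]Rintegral_mkcond.
apply: le_Rintegral => //.
- by rewrite -restrict_EFin; exact: (proj1 (@integrable_mkcond _ _ _ _ _ _ mD) i1).
- by rewrite -restrict_EFin; exact: (proj1 (@integrable_mkcond _ _ _ _ _ _ mD0) i2).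
move=> [w t] _; rewrite !patchE; case: ifPn => [|/negP]; rewrite inE /until/= => h1;
  case: ifPn => [|/negP]; rewrite inE /until/= => h2 //.
- have tt0 : t0 < t.
    have [t_ge _] := h1; rewrite ltNge; apply/negP => h3.
    by apply: h2; rewrite lee_fin.
  rewrite /payoff/= mul0r addr0 pmulr_rle0 ?expR_gt0//.
  have : - x / nu <= t0 by rewrite le_max lexx orbT.
  by rewrite ler_ndivrMr//; nra.
- have [t_ge] := h2; rewrite lee_fin => tt0.
  rewrite /payoff/= mul0r addr0 mulr_ge0 ?expR_ge0//.
  move: tt0; rewrite /t0 le_max => /orP[tl0|].
    have tE : t = 0 by apply/le_anti; rewrite tl0 t_ge.
    by case: h1; split => //; rewrite tE; have [] := st.
  by rewrite ler_ndivlMr//; lra.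
Qed.

Section grid.
Variables sigma x nu : R.
Hypothesis sigma0 : 0 < sigma.
Local Notation X := (state B sigma x nu).
Variables b K g h L : R.
Hypotheses (K0 : 0 < K) (g0 : 0 < g) (gE : g = - perpetuity alpha nu b).
Hypotheses (gK : alpha * g * K < 1) (h0 : 0 < h) (L0 : 0 <= L).
Hypothesis small_step :
  expR (- (alpha * h) - L * barrier_width alpha K g - (K + L) * nu * h +
        (K + L) ^+ 2 * sigma ^+ 2 * h / 2)
  <= expR ((sigma ^+ 2 * K ^+ 2 / 2 - nu * K - alpha) * h) - 1.
Local Notation W := (barrier_value alpha nu b K g).

(** [A] is the event that the state has stayed above [b] at the first [n + 1] grid
    points. Only its relation to [tau] and to the current state is needed for
    the next step, so that the strategy can be built by induction. *)
Lemma grid_strategy (t0 : R) (n : nat) : 0 <= t0 ->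
  exists tau A, let t := t0 + n%:R * h in
  [/\ stopping_time F tau, (forall w, (tau w <= t%:E)%E), F t A,
      (forall w, A w -> tau w = t%:E /\ b <= X t w) &
      expected_payoff sigma x nu (fun=> t0%:E) +
      expR (- (alpha * t0)) * \int[P]_(w in [set w | b <= X t0 w]) W (X t0 w) <=
      expected_payoff sigma x nu tau + expR (- (alpha * t)) * \int[P]_(w in A) W (X t w)].
Proof.
move=> t00; elim: n => [|n [tau [A [st tle FA Atau ih]]]].
  exists (fun=> t0%:E), [set w | b <= X t0 w]; rewrite /= mul0r addr0; split => //.
  - exact: stopping_time_cst.
  - exact: (adapted_state_ge HB x nu sigma0 b).
set s := t0 + n%:R * h in tle FA Atau ih *.
have s0 : 0 <= s by rewrite addr_ge0// mulr_ge0// ltW.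
pose u := t0 + n.+1%:R * h.
have uE : u = s + h by rewrite /u /s -natr1; ring.
have su : s < u by rewrite uE ltrDl.
have u0 := le_trans s0 (ltW su).
exists (extend_stop tau A u), (A `&` [set w | b <= X u w]); rewrite /= -/u.
have tauA w : A w -> tau w = s%:E by move=> /Atau[].
split.
- exact: (extend_stop_stopping HF s0 su).
- exact: (extend_stop_le _ su).
- apply: (filtrationI HF) => //; first exact: (filtration_mono HF s0 (ltW su)).
  exact: (adapted_state_ge HB x nu sigma0 b).
- by move=> w [Aw bw]; split => //; exact: extend_stop_in.
- apply: (le_trans ih); rewrite {2}/expected_payoff.
  rewrite (extend_stop_return HF HB sigma x nu alpha0 s0 su FA st tle tauA).
  rewrite -/(expected_payoff sigma x nu tau).
  have := grid_step HF HB alpha0 sigma0 K0 g0 gE h0 L0 small_step s0 FA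
     (fun w Aw => proj2 (Atau w Aw)) uE erefl.
  lra.
Qed.

End grid.

(** The sum of the one-step inequalities leaves the initial potential [I0], which
    is positive, and a final potential that discounting makes negligible after
    enough steps. *)
Lemma expected_payoff_gt (sigma x nu : R) : 0 < sigma -> nu < 0 ->
  xi alpha sigma nu < x ->
  exists2 tau, stopping_time F tau &
    expected_payoff 0 x nu (fun=> (Num.max 0 (- x / nu))%:E) <
    expected_payoff sigma x nu tau.
Proof.
move=> sigma0 nu0 xix; set t0 := Num.max _ _.
have t00 : 0 <= t0 by rewrite le_max lexx.
(* the mean of the state at time t0, equal to min x 0 *)
pose y := x + nu * t0.
have [xy y0] : xi alpha sigma nu < y /\ y <= 0.
  rewrite /y /t0; have [x0|x0] := leP x 0.
    by rewrite max_l ?mulr0 ?addr0// ler_ndivrMr// mul0r oppr_ge0.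
  rewrite max_r; last by rewrite ler_ndivlMr// mul0r oppr_le0 ltW.
  by rewrite mulrC divfK ?lt_eqF// subrr; split => //; exact: xi_lt0.
have [b [K [g [bY K0 g0 gE [gK lam0]]]]] := barrier_exists alpha0 sigma0 nu0 xy y0.
have w0 := barrier_width_gt0 alpha0 K0 g0 gK.
have [h [L [h0 L0 step]]] := small_step_exists alpha0 nu0 K0 w0 lam0.
have delta0 := barrier_slope_gt0 alpha0 gK.
pose W := barrier_value alpha nu b K g; pose X := state B sigma x nu.
pose I0 := \int[P]_(w in [set w | b <= X t0 w]) W (X t0 w).
have iW t A : 0 <= t -> measurable A -> P.-integrable A (EFin \o (fun w => W (X t w))).
  by move=> t_ge0 mA; exact: (integrable_barrier_value HF HB alpha sigma x nu b K g t_ge0 mA).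
have I00 : 0 < I0.
  have FA := adapted_state_ge HB x nu sigma0 b t00.
  have mA := filtration_measurable_set HF t00 FA.
  have iX := integrable_state HF HB sigma x nu t00 measurableT.
  have ib := finite_measure_integrable_cst P b measurableT.
  have iXb := integrableB measurableT iX ib.
  apply: (@lt_le_trans _ _ (\int[P]_w ((alpha^-1 - g * K) * (X t0 w - b)))).
    rewrite RintegralZl// RintegralB// mean_state// Rintegral_cst//.
    by rewrite PT mulr1 mulr_gt0// subr_gt0.
  rewrite /I0 [leRHS]Rintegral_mkcond; apply: le_Rintegral => //.
  - exact: (integrableZl measurableT _ iXb).
  - by rewrite -restrict_EFin; apply: (proj1 (@integrable_mkcond _ _ _ _ _ _ mA)); exact: iW.
  move=> w _; rewrite patchE; case: ifPn => [|/negP]; rewrite inE/= => bX.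
    exact: barrier_value_ge.
  by rewrite pmulr_rle0// subr_le0 leNgt; apply/negP => /ltW.
have [c c0 [k0 _]] := exp_rate_gt0_near0 sigma nu alpha0.
pose C := c^-1 * expR (c * (x - b)) / alpha.
have C0 : 0 < C by rewrite !(divr_gt0, mulr_gt0) ?expR_gt0 ?invr_gt0.
have tail t A : 0 <= t -> F t A -> (forall w, A w -> b <= X t w) ->
    expR (- (alpha * t)) * \int[P]_(w in A) W (X t w) <=
    C * expR (- (exp_rate alpha sigma nu c * t)).
  move=> t_ge0 FA bX; have mA := filtration_measurable_set HF t_ge0 FA.
  have iE := integrable_expX HF HB sigma x nu (- c) b t_ge0 measurableT.
  apply: (@le_trans _ _ (expR (- (alpha * t)) *
      \int[P]_w ((c^-1 / alpha) * expR (- c * (b - X t w))))).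
    rewrite ler_pM2l ?expR_gt0// Rintegral_mkcond; apply: le_Rintegral => //.
    - by rewrite -restrict_EFin; apply: (proj1 (@integrable_mkcond _ _ _ _ _ _ mA)); exact: iW.
    - exact: (integrableZl measurableT _ iE).
    move=> w _; rewrite patchE; case: ifPn => [|_]; last first.
      by rewrite mulr_ge0 ?expR_ge0// ltW// divr_gt0// invr_gt0.
    rewrite inE => /bX bXw; apply: (le_trans (barrier_value_le K0 g0 gE bXw)).
    rewrite mulrAC ler_pM2r ?invr_gt0// ler_pdivlMl// mulNr -mulrN opprB.
    by have := expR_ge1Dx (c * (X t w - b)); lra.
  rewrite RintegralZl// (Rintegral_expX_step HF HB sigma x nu (- c) b (lexx 0)
    t_ge0 (filtrationT HF (lexx 0))).
  under eq_Rintegral do rewrite /state (bm_start HB) !mulr0 !addr0.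
  rewrite Rintegral_cst// PT mulr1 /C.
  rewrite le_eqVlt; apply/orP; left; apply/eqP.
  transitivity (c^-1 / alpha * (expR (- (alpha * t)) * (expR (- c * (b - x)) *
    expR (- (- c * nu * (t - 0)) + (- c) ^+ 2 * sigma ^+ 2 * (t - 0) / 2)))); first by ring.
  transitivity (c^-1 / alpha *
    (expR (c * (x - b)) * expR (- (exp_rate alpha sigma nu c * t)))); last by ring.
  by rewrite -!expRD; congr (_ * expR _); rewrite /exp_rate; field.
have e0 : 0 < expR (- (alpha * t0)) * I0 by rewrite mulr_gt0 ?expR_gt0.
pose k := exp_rate alpha sigma nu c.
(* large enough for C exp (- k n h) <= C / (k n h) to be below the gain *)
pose n := (Num.trunc (C / (expR (- (alpha * t0)) * I0 * k * h))).+1.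
have [tau [A [st tle FA Atau ih]]] := grid_strategy x sigma0 K0 g0 gE h0 L0 step n t00.
exists tau => //.
rewrite (_ : expected_payoff 0 _ _ _ = expected_payoff sigma x nu (fun=> t0%:E)); last first.
  by rewrite !expected_payoff_cst.
set t := t0 + _ in tle FA Atau ih.
have t_ge0 : 0 <= t by rewrite addr_ge0// mulr_ge0// ltW.
have := tail t A t_ge0 FA (fun w Aw => proj2 (Atau w Aw)).
suff : C * expR (- (k * t)) < expR (- (alpha * t0)) * I0.
  by rewrite -/k -/I0 -/W -/X in ih *; lra.
have nP : C < n%:R * (expR (- (alpha * t0)) * I0 * k * h).
  rewrite -ltr_pdivrMr; first exact: truncnS_gt.
  by rewrite !mulr_gt0 ?expR_gt0.
have kt : n%:R * (k * h) < expR (k * t).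
  have : k * (n%:R * h) <= k * t by rewrite ler_pM2l// lerDr.
  by have := expR_ge1Dx (k * t); lra.
rewrite expRN ltr_pdivrMr ?expR_gt0//; apply: lt_trans nP _.
rewrite (_ : _ * _ = (expR (- (alpha * t0)) * I0) * (n%:R * (k * h))); last by ring.
by rewrite ltr_pM2l.
Qed.

End strategies.

(** * Strict monotonicity of the optimal return *)

(** This is the strict convexity inequality for the supremum of a family of affine
    functions; the bound [M] makes the supremum finite, hence comparable. *)
Lemma ereal_sup_interpolation_lt (R : realType) (T : Type) (S : set T)
    (j0 j1 j2 : T -> R) (l e M : R) :
  0 < l -> l < 1 ->
  (forall t, S t -> j1 t = l * j0 t + (1 - l) * j2 t) ->
  (forall t, S t -> j0 t <= e) -> (forall t, S t -> j2 t <= M) ->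
  (exists2 t, S t & e < j2 t) ->
  (ereal_sup [set (j1 t)%:E | t in S] < ereal_sup [set (j2 t)%:E | t in S])%E.
Proof.
move=> l0 l1 jE j0e j2M [t0 St0 et0]; set V := ereal_sup [set (j2 t)%:E | t in S].
have j2V t : S t -> ((j2 t)%:E <= V)%E by move=> St; apply: ereal_sup_ubound; exists t.
have VM : (V <= M%:E)%E.
  by apply: ge_ereal_sup => _ [t St <-]; rewrite lee_fin j2M.
have [v Vv] : exists v, V = v%:E.
  move: VM (j2V _ St0); case: V {j2V} => [v| |] //; by exists v.
have ev : e < v by rewrite -lte_fin -Vv; apply: lt_le_trans (j2V _ St0); rewrite lte_fin.
apply: (@le_lt_trans _ _ (l * e + (1 - l) * v)%:E); last by rewrite Vv lte_fin; nra.
apply: ge_ereal_sup => _ [t St <-]; rewrite lee_fin jE//.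
have := j2V _ St; rewrite Vv lee_fin => jv; have := j0e _ St.
by move=> h; apply: lerD; rewrite ler_pM2l// subr_gt0.
Qed.

Section optimal_return_monotone.
Context d (Omega : measurableType d) (R : realType) (P : probability Omega R).
Variables (F : R -> set_system Omega) (B : R -> {RV P >-> R}).
Hypotheses (HF : filtration F) (HB : brownian_motion F B).
Variable alpha : R.
Hypothesis alpha0 : 0 < alpha.
Local Notation J := (expected_payoff B alpha).

Lemma optimal_returnE (sigma x nu : R) :
  optimal_return F B alpha sigma x nu =
  ereal_sup [set (J sigma x nu tau)%:E | tau in stopping_time F].
Proof.
rewrite /optimal_return; congr ereal_sup; apply: eq_imagel => tau st.
by rewrite (discounted_returnE HF HB sigma x nu alpha0 st).
Qed.

Lemma expected_payoff_le_exp (sigma x nu c : R) tau :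
  0 < c -> 0 < exp_rate alpha sigma nu c -> stopping_time F tau ->
  J sigma x nu tau <= c^-1 * (expR (c * x) / exp_rate alpha sigma nu c).
Proof.
move=> c0 k0 st; apply: (payoff_integral_le HF HB) => //.
  exact: (measurable_until HF st).
by move=> z [].
Qed.

Lemma expected_payoff_bounded (sigma x nu : R) :
  exists M, forall tau, stopping_time F tau -> J sigma x nu tau <= M.
Proof.
have [c c0 [k0 _]] := exp_rate_gt0_near0 sigma nu alpha0.
by exists (c^-1 * (expR (c * x) / exp_rate alpha sigma nu c)) => tau; exact: expected_payoff_le_exp.
Qed.

Lemma optimal_return_sigma_lt (sigma1 sigma2 x nu : R) :
  0 < sigma1 -> sigma1 < sigma2 -> nu < 0 -> xi alpha sigma2 nu < x ->
  (optimal_return F B alpha sigma1 x nu < optimal_return F B alpha sigma2 x nu)%E.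
Proof.
move=> s10 s12 nu0 xix; have s20 := lt_trans s10 s12; rewrite !optimal_returnE.
have [M JM] := expected_payoff_bounded sigma2 x nu.
have sE : sigma1 / sigma2 * sigma2 = sigma1 by rewrite divfK// gt_eqF.
apply: (@ereal_sup_interpolation_lt _ _ _ (J 0 x nu) _ _ (1 - sigma1 / sigma2)
  (J 0 x nu (fun=> (Num.max 0 (- x / nu))%:E)) M) => //.
- by rewrite subr_gt0 ltr_pdivrMr// mul1r.
- by rewrite ltrBlDr ltrDl divr_gt0.
- move=> tau st; apply: (expected_payoff_affine HF HB alpha0 x st); last by ring.
  by rewrite mulr0 add0r subKr.
- by move=> tau st; exact: (deterministic_optimal HF HB alpha0 x nu0 st).
- exact: (expected_payoff_gt HF HB alpha0 s20 nu0 xix).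
Qed.

(** The auxiliary drift [nu0] is so negative that no stopping time earns more than
    half of what one of them earns with drift [nu2]. *)
Lemma optimal_return_nu_lt (sigma x nu1 nu2 : R) :
  0 < sigma -> nu1 < nu2 -> nu2 < 0 -> xi alpha sigma nu2 < x ->
  (optimal_return F B alpha sigma x nu1 < optimal_return F B alpha sigma x nu2)%E.
Proof.
move=> s0 n12 n20 xix; rewrite !optimal_returnE.
have [M JM] := expected_payoff_bounded sigma x nu2.
have [tau st Jtau] := expected_payoff_gt HF HB alpha0 s0 n20 xix.
have J0 : 0 < J sigma x nu2 tau.
  apply: le_lt_trans Jtau.
  apply: le_trans (deterministic_optimal HF HB alpha0 x n20
    (stopping_time_cst HF (lexx 0))).
  by rewrite (expected_payoff_cst HF HB)// !mulr0 oppr0 expR0 mul1r addr0 subrr.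
pose e := J sigma x nu2 tau / 2; have e0 : 0 < e by rewrite divr_gt0.
pose nu0 := Num.min (nu1 - 1) (alpha - sigma ^+ 2 / 2 - expR x / e).
have n01 : nu0 < nu1.
  by apply: (@le_lt_trans _ _ (nu1 - 1)); [rewrite ge_min lexx|rewrite ltrBlDr ltrDl].
have rate_ge : expR x / e <= exp_rate alpha sigma nu0 1.
  have : nu0 <= alpha - sigma ^+ 2 / 2 - expR x / e by rewrite ge_min lexx orbT.
  by rewrite /exp_rate expr1n mul1r mul1r; lra.
have rate0 : 0 < exp_rate alpha sigma nu0 1.
  by apply: lt_le_trans rate_ge; rewrite divr_gt0 ?expR_gt0.
have n02 : 0 < nu2 - nu0 by rewrite subr_gt0 (lt_trans n01).
apply: (@ereal_sup_interpolation_lt _ _ _ (J sigma x nu0) _ _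
  ((nu2 - nu1) / (nu2 - nu0)) e M) => //.
- by rewrite divr_gt0// subr_gt0.
- by rewrite ltr_pdivrMr// mul1r ltrD2l ltrN2.
- move=> tau' st'; apply: (expected_payoff_affine HF HB alpha0 x st'); first by ring.
  by field; rewrite gt_eqF.
- move=> tau' st'; apply: (le_trans (expected_payoff_le_exp x ltr01 rate0 st')).
  rewrite invr1 !mul1r ler_pdivrMr// mulrC -ler_pdivrMr//.
- by exists tau => //; rewrite /e; lra.
Qed.

End optimal_return_monotone.

Theorem proposition2 (R : realType) :
  (* (i) *)
  ([/\ forall alpha sigma1 sigma2 nu : R,
         0 < alpha -> 0 < sigma1 -> sigma1 < sigma2 -> nu < 0 ->
         psi alpha sigma2 nu < psi alpha sigma1 nu,
       forall alpha sigma nu1 nu2 : R,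
         0 < alpha -> 0 < sigma -> nu1 < nu2 -> nu2 < 0 ->
         psi alpha sigma nu2 < psi alpha sigma nu1 &
       forall alpha1 alpha2 sigma nu : R,
         0 < alpha1 -> alpha1 < alpha2 -> 0 < sigma -> nu < 0 ->
         psi alpha1 sigma nu < psi alpha2 sigma nu] /\
   [/\ forall alpha sigma1 sigma2 nu : R,
         0 < alpha -> 0 < sigma1 -> sigma1 < sigma2 -> nu < 0 ->
         phi alpha sigma1 nu < phi alpha sigma2 nu,
       forall alpha sigma nu1 nu2 : R,
         0 < alpha -> 0 < sigma -> nu1 < nu2 -> nu2 < 0 ->
         phi alpha sigma nu2 < phi alpha sigma nu1 &
       forall alpha1 alpha2 sigma nu : R,
         0 < alpha1 -> alpha1 < alpha2 -> 0 < sigma -> nu < 0 ->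
         phi alpha2 sigma nu < phi alpha1 sigma nu]) /\
  (* (ii) *)
  [/\ forall alpha sigma1 sigma2 nu : R,
        0 < alpha -> 0 < sigma1 -> sigma1 < sigma2 -> nu < 0 ->
        xi alpha sigma2 nu < xi alpha sigma1 nu,
      forall alpha sigma nu1 nu2 : R,
        0 < alpha -> 0 < sigma -> nu1 < nu2 -> nu2 < 0 ->
        xi alpha sigma nu2 < xi alpha sigma nu1 &
      forall alpha1 alpha2 sigma nu : R,
        0 < alpha1 -> alpha1 < alpha2 -> 0 < sigma -> nu < 0 ->
        xi alpha1 sigma nu < xi alpha2 sigma nu] /\
  (* (iii) *)
  (forall (d : measure_display) (Omega : measurableType d)
          (P : probability Omega R) (F : R -> set_system Omega)
          (B : R -> {RV P >-> R}),
     filtration F -> brownian_motion F B ->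
     (forall alpha sigma1 sigma2 x nu : R,
        0 < alpha -> 0 < sigma1 -> sigma1 < sigma2 -> nu < 0 ->
        xi alpha sigma2 nu < x ->
        (optimal_return F B alpha sigma1 x nu <
         optimal_return F B alpha sigma2 x nu)%E) /\
     (forall alpha sigma x nu1 nu2 : R,
        0 < alpha -> 0 < sigma -> nu1 < nu2 -> nu2 < 0 ->
        xi alpha sigma nu2 < x ->
        (optimal_return F B alpha sigma x nu1 <
         optimal_return F B alpha sigma x nu2)%E)).
Proof.
split; [split|split].
- split=> *; [exact: psi_sigma_lt|exact: psi_nu_lt|exact: psi_alpha_lt].
- split=> *; [exact: phi_sigma_lt|exact: phi_nu_lt|exact: phi_alpha_lt].
- split.
  + move=> alpha sigma1 sigma2 nu a0 s0 s12 _; have s20 := lt_trans s0 s12.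
    by apply: xi_lt_of_psi => //; exact: psi_sigma_lt.
  + by move=> alpha sigma nu1 nu2 a0 s0 n12 _; apply: xi_lt_of_psi => //; exact: psi_nu_lt.
  + move=> alpha1 alpha2 sigma nu a0 a12 s0 _; have a20 := lt_trans a0 a12.
    by apply: xi_lt_of_psi => //; exact: psi_alpha_lt.
- move=> d Omega P F B HF HB; split.
  + by move=> *; exact: optimal_return_sigma_lt.
  + by move=> *; exact: optimal_return_nu_lt.
Qed.
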